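(* Let $\alpha$ be a peak composition of $n$. Then the $H_n(0)$-module $\mathbf Q^{r}_\alpha$ is indecomposable.
   Context: $n$ is a positive integer, $\mathfrak S_n$ the symmetric group (product = composition of maps; permutations written as words), $s_i=(i,i+1)$, $\ell(\sigma)$ Coxeter length. $\mathrm{Des}_L(\sigma)=\{i:\ell(s_i\sigma)<\ell(\sigma)\}$, $\mathrm{Des}_R(\sigma)=\{i:\ell(\sigma s_i)<\ell(\sigma)\}$. $\preceq_L$ has covers $\sigma\prec s_i\sigma$, $i\notin\mathrm{Des}_L(\sigma)$; $[\sigma,\rho]_L$ is the interval for $\preceq_L$. For $S\subseteq[n-1]$, $w_1(S)$ is the longest element of $\{z\in\mathfrak S_n:\mathrm{Des}_R(z)\subseteq S\}$. For a composition $\alpha=(\alpha_1,\dots,\alpha_l)$ of $n$, $\ell(\alpha)=l$, $\mathrm{set}(\alpha)=\{\alpha_1,\dots,\alpha_1+\dots+\alpha_{l-1}\}$, $\alpha^r=(\alpha_l,\dots,\alpha_1)$. $\alpha$ is a peak composition if $\alpha_i\ne1$ for $1\le i<\ell(\alpha)$. $H_n(0)$ is the unital associative $\mathbb C$-algebra generated by $\overline\pi_1,\dots,\overline\pi_{n-1}$ with $\overline\pi_i^2=-\overline\pi_i$, $\overline\pi_i\overline\pi_{i+1}\overline\pi_i=\overline\pi_{i+1}\overline\pi_i\overline\pi_{i+1}$, $\overline\pi_i\overline\pi_j=\overline\pi_j\overline\pi_i$ for $|i-j|\ge2$. For a nonempty left weak Bruhat interval $I$, $\overline{\mathsf B}(I)$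 is the left $H_n(0)$-module with basis $I$ and $\overline\pi_i\star\gamma=-\gamma$ if $i\in\mathrm{Des}_L(\gamma)$; $=0$ if $i\notin\mathrm{Des}_L(\gamma)$, $s_i\gamma\notin I$; $=s_i\gamma$ if $i\notin\mathrm{Des}_L(\gamma)$, $s_i\gamma\in I$. The composition diagram of $\alpha$ is left-justified with $\alpha_i$ boxes in the $i$th row from the bottom. $\mathcal T''_\alpha$ is the filling of it having in column $1$, bottom to top, the first $\ell(\alpha)$ odd numbers; in column $2$, bottom to top, the first $\ell(\alpha)-1$ or $\ell(\alpha)$ even numbers (according to whether or not $\alpha_{\ell(\alpha)}=1$); and the remaining numbers of $\{1,\dots,n\}$ placed increasingly, left to right in each row, in the remaining boxes, top row first. $\mathrm w_{LT}$ reads each row left to right, top row first. $\mathbf Q^r_\alpha$ denotes the $H_n(0)$-module $\overline{\mathsf B}([\mathrm w_{LT}(\mathcal T''_\alpha),w_1(\mathrm{set}(\alpha^r))]_L)$ (up to isomorphism); it arises from an $H_n(0)$-module on standard peak immaculate tableaux of shape $\alpha$. *)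

(* Defs.v *)
From HB Require Import structures.
From mathcomp Require Import all_boot all_order all_algebra all_fingroup.
From mathcomp Require Import generic_quotient.
From mathcomp Require Import zify.
From mathcomp Require Import boolp reals complex.

Set Implicit Arguments.
Unset Strict Implicit.
Unset Printing Implicit Defensive.

Import GRing.Theory.
Local Open Scope ring_scope.
Local Open Scope quotient_scope.

(* [i : 'I_n.-1] stands for the index i + 1 of [n - 1],  *)
(* and ['S_n] acts on {0, ..., n - 1}.  The product of [perm] is              *)
(* (s * t) k = t (s k), the reverse of the composition of maps, so that the   *)
(* composite s_i sigma is written [sigma * sref i] below.                     *)

Lemma ord_lo_subproof n (i : 'I_n.-1) : (i < n)%N.
Proof. by case: i => i /=; lia. Qed.

Lemma ord_hi_subproof n (i : 'I_n.-1) : (i.+1 < n)%N.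
Proof. by case: i => i /=; lia. Qed.

Definition ord_lo n (i : 'I_n.-1) : 'I_n := Ordinal (ord_lo_subproof i).
Definition ord_hi n (i : 'I_n.-1) : 'I_n := Ordinal (ord_hi_subproof i).

Definition sref n (i : 'I_n.-1) : 'S_n := tperm (ord_lo i) (ord_hi i).

Definition is_word_length n (x : 'S_n) (k : nat) : bool :=
  [exists w : k.-tuple 'I_n.-1, x == (\prod_(i <- w) sref i)%g].

Section Inversions.
Variable n : nat.
Implicit Types (x g : 'S_n) (i j : 'I_n.-1).

Definition invset g : {set 'I_n * 'I_n} :=
  [set p : 'I_n * 'I_n | (p.1 < p.2)%N && (g p.2 < g p.1)%N].

Definition posdes x i : bool := (x^-1%g (ord_hi i) < x^-1%g (ord_lo i))%N.

Lemma srefK i : (sref i * sref i)%g = 1%g.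
Proof. exact: tperm2. Qed.

Lemma srefKr x i : (x * sref i * sref i)%g = x.
Proof. by rewrite -mulgA srefK mulg1. Qed.

Lemma sref_lo i : sref i (ord_lo i) = ord_hi i.
Proof. exact: tpermL. Qed.

Lemma sref_hi i : sref i (ord_hi i) = ord_lo i.
Proof. exact: tpermR. Qed.

Lemma sref_val i (k : 'I_n) :
  sref i k = (if k == i :> nat then i.+1
              else if k == i.+1 :> nat then i : nat else k) :> nat.
Proof.
rewrite /sref; case: tpermP => [->|->|/eqP + /eqP] /=.
- by rewrite eqxx.
- by rewrite eqxx; case: eqP => //; lia.
by rewrite -!val_eqE /= => /negPf -> /negPf ->.
Qed.

Lemma pos_sref x i k : (x * sref i)^-1%g k = x^-1%g (sref i k).
Proof. by rewrite invMg permM tpermV. Qed.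

Lemma posdes_sref x i : posdes (x * sref i)%g i = ~~ posdes x i.
Proof.
rewrite /posdes !pos_sref sref_lo sref_hi -leqNgt ltn_neqAle.
rewrite val_eqE (inj_eq perm_inj) -val_eqE /=.
by have -> : (i == i.+1 :> nat) = false by lia.
Qed.

Lemma invset_sref x i : ~~ posdes x i ->
  #|invset (x * sref i)^-1%g| = #|invset x^-1%g|.+1.
Proof.
move=> ndes.
pose f (p : 'I_n * 'I_n) := (sref i p.1, sref i p.2).
have f_inj : injective f.
  by move=> [a b] [c d] [/perm_inj -> /perm_inj ->].
have -> : invset (x * sref i)^-1%g
          = (ord_lo i, ord_hi i) |: [set f p | p in invset x^-1%g].
  apply/setP => -[a b]; rewrite !inE /=.
  have fK p : f (f p) = p by case: p => ? ?; rewrite /f /= !tpermK.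
  have -> : ((a, b) \in [set f p | p in invset x^-1%g])
            = (f (a, b) \in invset x^-1%g).
    by rewrite -{1}[(a, b)]fK mem_imset.
  rewrite !inE /= !pos_sref xpair_eqE.
  have [/andP [/eqP -> /eqP ->]|nab] /= :=
    boolP ((a == ord_lo i) && (b == ord_hi i)).
    rewrite sref_lo sref_hi /= (ltnSn i) /=.
    have := posdes_sref x i; rewrite (negPf ndes) /= /posdes !pos_sref.
    by rewrite sref_lo sref_hi => ->.
  have [/andP [/eqP ha /eqP hb]|nba] := boolP ((a == ord_hi i) && (b == ord_lo i)).
    rewrite ha hb sref_lo sref_hi /=.
    have -> : (i.+1 < i)%N = false by lia.
    by rewrite (ltnSn i) /= (negPf (ndes : ~~ (_ < _)%N)).
  congr (_ && _); move: nab nba; rewrite -!val_eqE /= !sref_val.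
  do !case: eqP => //=; lia.
rewrite cardsU1 card_imset //.
suff -> : (ord_lo i, ord_hi i) \notin [set f p | p in invset x^-1%g] by [].
apply/negP => /imsetP [[a b]]; rewrite !inE /= => /andP [lt_ab _] [].
move=> /(congr1 val) /= ea /(congr1 val) /= eb.
by move: ea eb lt_ab; rewrite !sref_val; do !case: eqP => //=; lia.
Qed.

Lemma invset_sref_des x i : posdes x i ->
  #|invset x^-1%g| = #|invset (x * sref i)^-1%g|.+1.
Proof.
move=> des; rewrite -(@invset_sref (x * sref i)%g i) ?srefKr //.
by rewrite posdes_sref negbK.
Qed.

Lemma nodes_id x : (forall i, ~~ posdes x i) -> x = 1%g.
Proof.
move=> nd; apply: invg_inj; rewrite invg1; set g := x^-1%g.
have step (a b : 'I_n) : b = a.+1 :> nat -> (g a < g b)%N.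
  move=> eab; have lt_a : (a < n.-1)%N by have := ltn_ord b; lia.
  have := nd (Ordinal lt_a); rewrite /posdes -leqNgt.
  have -> : ord_lo (Ordinal lt_a) = a by apply: val_inj.
  have -> : ord_hi (Ordinal lt_a) = b by apply: val_inj; rewrite /= eab.
  rewrite leq_eqVlt => /orP [/eqP /val_inj /perm_inj eq_ab|//].
  by move: eab; rewrite eq_ab; lia.
have mono d : forall a b : 'I_n, b = (a + d)%N :> nat -> (g a + d <= g b)%N.
  elim: d => [|d IH] a b eab.
    by rewrite addn0 (_ : b = a) //; apply: val_inj; rewrite /= eab addn0.
  have lt_c : (a + d < n)%N by have := ltn_ord b; lia.
  have := IH a (Ordinal lt_c) erefl.
  by have := @step (Ordinal lt_c) b; rewrite /= eab addnS => /(_ erefl); lia.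
apply/permP => k; rewrite perm1; apply: val_inj => /=.
have n0 : (0 < n)%N by case: k => k; lia.
have ltm : (n.-1 < n)%N by lia.
have := mono k (Ordinal n0) k erefl.
have := mono (n.-1 - k)%N k (Ordinal ltm).
have /= := ltn_ord (g (Ordinal ltm)); have := ltn_ord k.
by move=> ? ? h; have := h _; rewrite /=; lia.
Qed.

Lemma word_length_rcons x i k :
  is_word_length x k -> is_word_length (x * sref i)%g k.+1.
Proof.
case/existsP => w /eqP ->; apply/existsP.
by exists [tuple of rcons w i]; rewrite big_rcons.
Qed.

Lemma word_length_inv x : is_word_length x #|invset x^-1%g|.
Proof.
move: {2}#|_| (erefl #|invset x^-1%g|) => m; elim: m x => [|m IH] x em.
  rewrite em; have -> : x = 1%g.
    by apply: nodes_id => i; apply/negP => /invset_sref_des; rewrite em.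
  by apply/existsP; exists [tuple]; rewrite big_nil.
have [[i des]|nd] := pselect (exists i, posdes x i).
  rewrite (invset_sref_des des) -{1}[x](srefKr _ i); apply: word_length_rcons.
  by apply: IH; apply: succn_inj; rewrite -(invset_sref_des des).
have x1 : x = 1%g by apply: nodes_id => i; apply/negP => d; apply: nd; exists i.
move: em; rewrite x1 invg1.
rewrite (_ : invset 1%g = set0) ?cards0 //; apply/setP => -[a b].
by rewrite !inE /= !perm1; lia.
Qed.

Lemma word_length_ge x k : is_word_length x k -> (#|invset x^-1%g| <= k)%N.
Proof.
case/existsP => w /eqP ->; case: w => w /= /eqP <-.
elim/last_ind: w => [|w i IH].
  rewrite big_nil invg1 (_ : invset 1%g = set0) ?cards0 //; apply/setP => -[a b].
  by rewrite !inE /= !perm1; lia.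
rewrite big_rcons /= size_rcons; set y := (\prod_(_ <- w) _)%g in IH *.
have [des|nd] := boolP (posdes y i); last by rewrite invset_sref.
by move: IH; rewrite (invset_sref_des des) => /ltnW /leqW.
Qed.

Lemma ex_word_length x : exists k, is_word_length x k.
Proof. by exists #|invset x^-1%g|; apply: word_length_inv. Qed.

End Inversions.

Definition coxeter_length n (x : 'S_n) : nat := ex_minn (ex_word_length x).

Lemma coxeter_lengthE n (x : 'S_n) : coxeter_length x = #|invset x^-1%g|.
Proof.
rewrite /coxeter_length; case: ex_minnP => k wk mink.
by apply/eqP; rewrite eqn_leq word_length_ge // mink // word_length_inv.
Qed.

Definition DesL n (x : 'S_n) : {set 'I_n.-1} :=
  [set i | (coxeter_length (x * sref i)%g < coxeter_length x)%N].

Definition DesR n (x : 'S_n) : {set 'I_n.-1} :=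
  [set i | (coxeter_length (sref i * x)%g < coxeter_length x)%N].

Lemma in_DesL n (x : 'S_n) i : (i \in DesL x) = posdes x i.
Proof.
rewrite inE !coxeter_lengthE; have [des|nd] := boolP (posdes x i).
  by rewrite (invset_sref_des des) ltnSn.
by rewrite (invset_sref nd) ltnNge leqnSn.
Qed.

Definition weakL_cover n : rel 'S_n :=
  fun x y => [exists i, (i \notin DesL x) && (y == (x * sref i)%g)].

Definition weakL n : rel 'S_n := connect (@weakL_cover n).

Definition weakL_interval n (x y : 'S_n) : {set 'S_n} :=
  [set z | weakL x z && weakL z y].

Definition w1 n (S : {set 'I_n.-1}) : 'S_n :=
  [arg max_(z > (1%g : 'S_n) | DesR z \subset S) coxeter_length z].

(* The unital associative algebra presented by generators [X] and relations   *)
(* [rels]: terms modulo the smallest congruence containing the axioms of       *)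
(* unital associative algebras and [rels].                                     *)

Inductive alg_term (F X : Type) : Type :=
  | Gen of X
  | Cst of F
  | Add of alg_term F X & alg_term F X
  | Mul of alg_term F X & alg_term F X.

Arguments Gen {F X}.
Arguments Cst {F X}.

HB.instance Definition _ (F X : Type) := gen_eqMixin (alg_term F X).
HB.instance Definition _ (F X : Type) := gen_choiceMixin (alg_term F X).

Section Presentation.
Variables (F : fieldType) (X : Type) (rels : alg_term F X -> alg_term F X -> Prop).
Local Notation term := (alg_term F X).
Implicit Types (s t u : term) (a b : F).

Inductive alg_cong : term -> term -> Prop :=
  | cong_refl t : alg_cong t t
  | cong_sym s t : alg_cong s t -> alg_cong t s
  | cong_trans s t u : alg_cong s t -> alg_cong t u -> alg_cong s u
  | cong_Add s s' t t' :
      alg_cong s s' -> alg_cong t t' -> alg_cong (Add s t) (Add s' t')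
  | cong_Mul s s' t t' :
      alg_cong s s' -> alg_cong t t' -> alg_cong (Mul s t) (Mul s' t')
  | cong_CstD a b : alg_cong (Cst (a + b)) (Add (Cst a) (Cst b))
  | cong_CstM a b : alg_cong (Cst (a * b)) (Mul (Cst a) (Cst b))
  | cong_CstC a t : alg_cong (Mul (Cst a) t) (Mul t (Cst a))
  | cong_AddA s t u : alg_cong (Add s (Add t u)) (Add (Add s t) u)
  | cong_AddC s t : alg_cong (Add s t) (Add t s)
  | cong_Add0 t : alg_cong (Add (Cst 0) t) t
  | cong_MulA s t u : alg_cong (Mul s (Mul t u)) (Mul (Mul s t) u)
  | cong_Mul0 t : alg_cong (Mul (Cst 0) t) (Cst 0)
  | cong_Mul1 t : alg_cong (Mul (Cst 1) t) t
  | cong_MulDl s t u : alg_cong (Mul (Add s t) u) (Add (Mul s u) (Mul t u))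
  | cong_MulDr s t u : alg_cong (Mul s (Add t u)) (Add (Mul s t) (Mul s u))
  | cong_rel s t : rels s t -> alg_cong s t.

Definition alg_congb : rel term := fun s t => `[< alg_cong s t >].

Lemma alg_congb_equiv : equiv_class_of alg_congb.
Proof.
split=> [t|s t|t s u]; first exact/asboolP/cong_refl.
  by apply/asboolP/asboolP; apply: cong_sym.
by move=> /asboolP st /asboolP tu; apply/asboolP/(cong_trans st).
Qed.

Canonical alg_cong_equiv := EquivRelPack alg_congb_equiv.

Definition pres_alg : Type := {eq_quot alg_cong_equiv}.
HB.instance Definition _ := Choice.on pres_alg.

Definition pa_class (t : term) : pres_alg := \pi_({eq_quot alg_cong_equiv}) t.
Definition pa_repr (h : pres_alg) : term := repr (h : {eq_quot alg_cong_equiv}).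

Lemma pa_reprK h : pa_class (pa_repr h) = h.
Proof. exact: reprK. Qed.

Lemma pa_eqP s t : pa_class s = pa_class t <-> alg_cong s t.
Proof.
by split=> [/eqmodP /asboolP|st] //; apply/eqmodP/asboolP.
Qed.

Lemma pa_repr_cong t : alg_cong (pa_repr (pa_class t)) t.
Proof. by apply/pa_eqP; rewrite pa_reprK. Qed.

Definition pa_add (g h : pres_alg) := pa_class (Add (pa_repr g) (pa_repr h)).
Definition pa_mul (g h : pres_alg) := pa_class (Mul (pa_repr g) (pa_repr h)).
Definition pa_scale a (h : pres_alg) := pa_class (Mul (Cst a) (pa_repr h)).
Definition pa_opp (h : pres_alg) := pa_scale (-1) h.

Lemma pa_addE s t : pa_add (pa_class s) (pa_class t) = pa_class (Add s t).
Proof. by apply/pa_eqP/cong_Add; apply: pa_repr_cong. Qed.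

Lemma pa_mulE s t : pa_mul (pa_class s) (pa_class t) = pa_class (Mul s t).
Proof. by apply/pa_eqP/cong_Mul; apply: pa_repr_cong. Qed.

Lemma pa_scaleE a t : pa_scale a (pa_class t) = pa_class (Mul (Cst a) t).
Proof. by apply/pa_eqP/cong_Mul; [apply: cong_refl | apply: pa_repr_cong]. Qed.

Lemma pa_ind (P : pres_alg -> Prop) : (forall t, P (pa_class t)) -> forall h, P h.
Proof. by move=> Pc h; rewrite -[h]pa_reprK. Qed.

Lemma pa_addA : associative pa_add.
Proof.
elim/pa_ind => s; elim/pa_ind => t; elim/pa_ind => u.
by rewrite !pa_addE; apply/pa_eqP/cong_AddA.
Qed.

Lemma pa_addC : commutative pa_add.
Proof.
by elim/pa_ind => s; elim/pa_ind => t; rewrite !pa_addE; apply/pa_eqP/cong_AddC.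
Qed.

Lemma pa_add0 : left_id (pa_class (Cst 0)) pa_add.
Proof. by elim/pa_ind => t; rewrite pa_addE; apply/pa_eqP/cong_Add0. Qed.

Lemma pa_addN : left_inverse (pa_class (Cst 0)) pa_opp pa_add.
Proof.
elim/pa_ind => t; rewrite /pa_opp pa_scaleE pa_addE; apply/pa_eqP.
apply: cong_trans (cong_Mul0 t); rewrite -(addNr (1 : F)).
apply: cong_trans (cong_Mul (cong_sym (cong_CstD _ _)) (cong_refl t)).
apply: cong_trans (cong_sym (cong_MulDl _ _ _)).
by apply: cong_Add; [apply: cong_refl | apply/cong_sym/cong_Mul1].
Qed.

HB.instance Definition _ :=
  GRing.isZmodule.Build pres_alg pa_addA pa_addC pa_add0 pa_addN.

Lemma pa_mulA : associative pa_mul.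
Proof.
elim/pa_ind => s; elim/pa_ind => t; elim/pa_ind => u.
by rewrite !pa_mulE; apply/pa_eqP/cong_MulA.
Qed.

Lemma pa_mul1 : left_id (pa_class (Cst 1)) pa_mul.
Proof. by elim/pa_ind => t; rewrite pa_mulE; apply/pa_eqP/cong_Mul1. Qed.

Lemma pa_mulr1 : right_id (pa_class (Cst 1)) pa_mul.
Proof.
elim/pa_ind => t; rewrite pa_mulE; apply/pa_eqP.
exact: cong_trans (cong_sym (cong_CstC _ _)) (cong_Mul1 t).
Qed.

Lemma pa_mulDl : left_distributive pa_mul +%R.
Proof.
elim/pa_ind => s; elim/pa_ind => t; elim/pa_ind => u; rewrite -![_ + _]/(pa_add _ _).
by rewrite !(pa_addE, pa_mulE); apply/pa_eqP/cong_MulDl.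
Qed.

Lemma pa_mulDr : right_distributive pa_mul +%R.
Proof.
elim/pa_ind => s; elim/pa_ind => t; elim/pa_ind => u; rewrite -![_ + _]/(pa_add _ _).
by rewrite !(pa_addE, pa_mulE); apply/pa_eqP/cong_MulDr.
Qed.

HB.instance Definition _ := GRing.Zmodule_isPzRing.Build pres_alg
  pa_mulA pa_mul1 pa_mulr1 pa_mulDl pa_mulDr.

Lemma pa_scaleA a b h : pa_scale a (pa_scale b h) = pa_scale (a * b) h.
Proof.
elim/pa_ind: h => t; rewrite !pa_scaleE; apply/pa_eqP.
apply: cong_trans (cong_MulA _ _ _) _.
exact: cong_Mul (cong_sym (cong_CstM _ _)) (cong_refl _).
Qed.

Lemma pa_scale1 : left_id 1 pa_scale.
Proof. by elim/pa_ind => t; rewrite pa_scaleE; apply/pa_eqP/cong_Mul1. Qed.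

Lemma pa_scaleDr : right_distributive pa_scale +%R.
Proof.
move=> a; elim/pa_ind => s; elim/pa_ind => t; rewrite -![_ + _]/(pa_add _ _).
by rewrite !(pa_addE, pa_scaleE); apply/pa_eqP/cong_MulDr.
Qed.

Lemma pa_scaleDl h : {morph pa_scale^~ h : a b / a + b}.
Proof.
elim/pa_ind: h => t a b /=; rewrite -![_ + _ : pres_alg]/(pa_add _ _).
rewrite !(pa_addE, pa_scaleE); apply/pa_eqP.
exact: cong_trans (cong_Mul (cong_CstD _ _) (cong_refl _)) (cong_MulDl _ _ _).
Qed.

HB.instance Definition _ := GRing.Zmodule_isLmodule.Build F pres_alg
  pa_scaleA pa_scale1 pa_scaleDr pa_scaleDl.

Lemma pa_scalerAl a (g h : pres_alg) : a *: (g * h) = a *: g * h.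
Proof.
elim/pa_ind: g => s; elim/pa_ind: h => t.
rewrite -![_ * _]/(pa_mul _ _) -![_ *: _]/(pa_scale _ _).
by rewrite !(pa_mulE, pa_scaleE); apply/pa_eqP/cong_MulA.
Qed.

Lemma pa_scalerAr a (g h : pres_alg) : a *: (g * h) = g * (a *: h).
Proof.
elim/pa_ind: g => s; elim/pa_ind: h => t.
rewrite -![_ * _]/(pa_mul _ _) -![_ *: _]/(pa_scale _ _).
rewrite !(pa_mulE, pa_scaleE); apply/pa_eqP.
apply: cong_trans (cong_MulA _ _ _) _; apply: cong_trans (cong_sym (cong_MulA _ _ _)).
exact: cong_Mul (cong_CstC _ _) (cong_refl _).
Qed.

Section Action.
Variables (V : lmodType F) (p : X -> V -> V).
Hypothesis p_lin : forall x a (u v : V), p x (a *: u + v) = a *: p x u + p x v.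

Fixpoint term_act (t : term) (v : V) : V :=
  match t with
  | Gen x => p x v
  | Cst a => a *: v
  | Add s t => term_act s v + term_act t v
  | Mul s t => term_act s (term_act t v)
  end.

Hypothesis p_rel : forall s t, rels s t -> term_act s =1 term_act t.

Lemma term_act_lin t a (u v : V) :
  term_act t (a *: u + v) = a *: term_act t u + term_act t v.
Proof.
elim: t u v => [x|b|s IHs t IHt|s IHs t IHt] u v /=; first exact: p_lin.
- by rewrite scalerDr !scalerA mulrC.
- by rewrite IHs IHt scalerDr addrACA.
- by rewrite IHt IHs.
Qed.

Lemma term_actD t (u v : V) : term_act t (u + v) = term_act t u + term_act t v.
Proof. by rewrite -{1}[u]scale1r term_act_lin scale1r. Qed.

Lemma term_act0 t : term_act t 0 = 0.
Proof. by apply: (addrI (term_act t 0)); rewrite -term_actD !addr0. Qed.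

Lemma term_actZ t a (v : V) : term_act t (a *: v) = a *: term_act t v.
Proof. by rewrite -[a *: v]addr0 term_act_lin term_act0 addr0. Qed.

Lemma term_act_cong s t : alg_cong s t -> term_act s =1 term_act t.
Proof.
elim=> {s t}.
- by [].
- by move=> s t _ IH v; rewrite IH.
- by move=> s t u _ IH1 _ IH2 v; rewrite IH1 IH2.
- by move=> s s' t t' _ IH1 _ IH2 v /=; rewrite IH1 IH2.
- by move=> s s' t t' _ IH1 _ IH2 v /=; rewrite IH2 IH1.
- by move=> a b v /=; rewrite scalerDl.
- by move=> a b v /=; rewrite scalerA.
- by move=> a t v /=; rewrite term_actZ.
- by move=> s t u v /=; rewrite addrA.
- by move=> s t v /=; rewrite addrC.
- by move=> t v /=; rewrite scale0r add0r.
- by [].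
- by move=> t v /=; rewrite !scale0r.
- by move=> t v /=; rewrite scale1r.
- by [].
- by move=> s t u v /=; rewrite term_actD.
- exact: p_rel.
Qed.

Definition pa_act (h : pres_alg) (v : V) : V := term_act (pa_repr h) v.

Lemma pa_actE t v : pa_act (pa_class t) v = term_act t v.
Proof. exact: term_act_cong (pa_repr_cong t) v. Qed.

Lemma pa_actA (g h : pres_alg) v : pa_act g (pa_act h v) = pa_act (g * h) v.
Proof.
elim/pa_ind: g => s; elim/pa_ind: h => t; rewrite -[_ * _]/(pa_mul _ _).
by rewrite pa_mulE !pa_actE.
Qed.

Lemma pa_act1 : left_id 1 pa_act.
Proof. by move=> v; rewrite -[1]/(pa_class (Cst 1)) pa_actE /= scale1r. Qed.

Lemma pa_actDr : right_distributive pa_act +%R.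
Proof. by elim/pa_ind => t u v; rewrite !pa_actE term_actD. Qed.

Lemma pa_actDl v : {morph pa_act^~ v : g h / g + h}.
Proof.
elim/pa_ind => s; elim/pa_ind => t; rewrite -[_ + _ : pres_alg]/(pa_add _ _).
by rewrite pa_addE !pa_actE.
Qed.

End Action.

End Presentation.

Inductive hecke0_rel (F : fieldType) n :
    alg_term F 'I_n.-1 -> alg_term F 'I_n.-1 -> Prop :=
  | hecke0_sqr (i : 'I_n.-1) : hecke0_rel (Mul (Gen i) (Gen i)) (Mul (Cst (-1)) (Gen i))
  | hecke0_braid (i j : 'I_n.-1) : j = i.+1 :> nat ->
      hecke0_rel (Mul (Gen i) (Mul (Gen j) (Gen i)))
                 (Mul (Gen j) (Mul (Gen i) (Gen j)))
  | hecke0_comm (i j : 'I_n.-1) : (i.+1 < j)%N ->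
      hecke0_rel (Mul (Gen i) (Gen j)) (Mul (Gen j) (Gen i)).

Definition hecke0 (F : fieldType) (n : nat) : Type := pres_alg (@hecke0_rel F n).

Section Hecke0.
Variables (F : fieldType) (n : nat).
Local Notation H := (hecke0 F n).

HB.instance Definition _ := GRing.PzRing.on H.

Lemma hecke0_1_neq0 : (1 : H) != 0.
Proof.
pose p (i : 'I_n.-1) (v : F^o) : F^o := 0.
have plin x a u v : p x (a *: u + v) = a *: p x u + p x v.
  by rewrite /p scaler0 addr0.
have prel s t : hecke0_rel s t -> term_act p s =1 term_act p t.
  by case=> * v //=; rewrite /p scaler0.
apply/eqP => e10.
have: pa_act p (1 : H) 1 = pa_act p (0 : H) 1 by rewrite e10.
rewrite -[1 in LHS]/(pa_class _ (Cst 1)) -[0 in RHS]/(pa_class _ (Cst 0)).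
rewrite !pa_actE //= scale1r scale0r => /eqP; apply/negP; exact: oner_neq0.
Qed.

HB.instance Definition _ := GRing.PzSemiRing_isNonZero.Build H hecke0_1_neq0.
HB.instance Definition _ := GRing.Lmodule.on H.
HB.instance Definition _ :=
  GRing.Lmodule_isLalgebra.Build F H (@pa_scalerAl F _ (@hecke0_rel F n)).
HB.instance Definition _ :=
  GRing.Lalgebra_isAlgebra.Build F H (@pa_scalerAr F _ (@hecke0_rel F n)).

Definition hecke0_gen (i : 'I_n.-1) : H := pa_class _ (Gen i).

End Hecke0.

Section IntervalModule.
Variables (F : fieldType) (n : nat) (x y : 'S_n).
Local Notation I := (weakL_interval x y).
Local Notation V := {ffun {z | z \in I} -> F^o}.
Implicit Types (z w : 'S_n) (i j : 'I_n.-1) (v : V).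

Definition im_elt (z : 'S_n) : V := [ffun u => (val u == z)%:R].

Definition im_star (i : 'I_n.-1) (z : 'S_n) : V :=
  if i \in DesL z then - im_elt z
  else if (z * sref i)%g \in I then im_elt (z * sref i)%g
  else 0.

Definition im_op (i : 'I_n.-1) (v : V) : V :=
  \sum_(u : {z | z \in I}) v u *: im_star i (val u).

Lemma im_op_lin i a (u v : V) : im_op i (a *: u + v) = a *: im_op i u + im_op i v.
Proof.
rewrite /im_op scaler_sumr -big_split; apply: eq_bigr => w _ /=.
by rewrite !ffunE scalerDl scalerA.
Qed.

Lemma im_elt_out z : z \notin I -> im_elt z = 0.
Proof.
move=> zI; apply/ffunP => u; rewrite !ffunE; case: eqP => // uz.
by move: zI; rewrite -uz (valP u).
Qed.

Lemma im_expand (v : V) : v = \sum_(u : {z | z \in I}) v u *: im_elt (val u).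
Proof.
apply/ffunP => w; rewrite sum_ffunE (bigD1 w) //= big1 => [|u nuw].
  by rewrite !ffunE eqxx addr0 /GRing.scale /= mulr1.
by rewrite !ffunE (inj_eq val_inj) eq_sym (negPf nuw) scaler0.
Qed.

Lemma im_op_elt i z : z \in I -> im_op i (im_elt z) = im_star i z.
Proof.
move=> zI; rewrite /im_op (bigD1 (exist _ z zI)) //= big1 => [|u nuz].
  by rewrite ffunE eqxx scale1r addr0.
rewrite ffunE (_ : val u == z = false) ?scale0r //.
by apply: contraNF nuz => /eqP uz; apply/eqP/val_inj.
Qed.

Lemma im_op0 i : im_op i 0 = 0.
Proof. by rewrite /im_op big1 // => u _; rewrite ffunE scale0r. Qed.

Lemma im_opN i v : im_op i (- v) = - im_op i v.
Proof. by have := im_op_lin i (-1) v 0; rewrite im_op0 !addr0 !scaleN1r. Qed.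

Lemma weakL_step z i : ~~ posdes z i -> weakL z (z * sref i)%g.
Proof.
by move=> nd; apply/connect1/existsP; exists i; rewrite in_DesL nd eqxx.
Qed.

(* Above x the membership test in [im_star] is redundant: I is convex. *)
Lemma im_op_up i z : weakL x z -> im_op i (im_elt z) =
  if posdes z i then - im_elt z else im_elt (z * sref i)%g.
Proof.
move=> xz; have [zI|zI] := boolP (z \in I).
  rewrite im_op_elt // /im_star in_DesL; case: ifP => // _.
  by case: ifP => // /negbT /im_elt_out.
rewrite (im_elt_out zI) im_op0 oppr0; case: ifP => // /negbT nd.
rewrite im_elt_out //; apply: contra zI; rewrite !inE xz /= => /andP [_].
exact/connect_trans/weakL_step.
Qed.

Lemma im_rel s t : hecke0_rel s t -> term_act im_op s =1 term_act im_op t.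
Proof.
move=> st v; rewrite (im_expand v).
have ext (r : alg_term F 'I_n.-1) : term_act im_op r
    (\sum_(u : {z | z \in I}) v u *: im_elt (val u)) =
    \sum_(u : {z | z \in I}) v u *: term_act im_op r (im_elt (val u)).
  rewrite (big_morph _ (term_actD im_op_lin r) (term_act0 im_op_lin r)).
  by apply: eq_bigr => u _; rewrite (term_actZ im_op_lin).
rewrite !ext; apply: eq_bigr => -[z zI] _ /=; congr (_ *: _).
have {zI} xz : weakL x z by move: zI; rewrite inE => /andP [].
have up w i : weakL x w -> ~~ posdes w i -> weakL x (w * sref i)%g.
  by move=> xw /weakL_step; apply: connect_trans.
case: st => {s t v ext} [i|i j eij|i j lij] /=.
- rewrite scaleN1r im_op_up //; have [d|nd] := boolP (posdes z i).
    by rewrite im_opN im_op_up // d.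
  by rewrite im_op_up ?up // posdes_sref nd.
- have hij : ord_hi i = ord_lo j by apply: val_inj; rewrite /= eij.
  pose a := z^-1%g (ord_lo i); pose b := z^-1%g (ord_lo j).
  pose c := z^-1%g (ord_hi j).
  have sij : sref i (ord_hi j) = ord_hi j.
    by apply: val_inj; rewrite /= sref_val /= eij; do !case: eqP => //=; lia.
  have sji : sref j (ord_lo i) = ord_lo i.
    by apply: val_inj; rewrite /= sref_val /= eij; do !case: eqP => //=; lia.
  have sijl : sref i (ord_lo j) = ord_lo i by rewrite -hij sref_hi.
  have pd := (pos_sref, hij, sref_lo, sref_hi, sij, sji, sijl).
  have braid : (z * sref i * sref j * sref i)%g = (z * sref j * sref i * sref j)%g.
    rewrite -!mulgA; congr (_ * _)%g; apply/permP => k; rewrite !permM.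
    apply: val_inj; rewrite /= !sref_val eij; do !case: eqP => //=; lia.
  have nab : a != b :> nat by rewrite val_eqE (inj_eq perm_inj) -val_eqE /= eij; lia.
  have nac : a != c :> nat by rewrite val_eqE (inj_eq perm_inj) -val_eqE /= eij; lia.
  have nbc : b != c :> nat by rewrite val_eqE (inj_eq perm_inj) -val_eqE /=; lia.
  have Ei : posdes z i = (b < a)%N by rewrite /posdes hij.
  have Ej : posdes z j = (c < b)%N by [].
  have Eii : posdes (z * sref i) i = (a < b)%N by rewrite /posdes !pd.
  have Eij : posdes (z * sref i) j = (c < a)%N by rewrite /posdes !pd.
  have Eji : posdes (z * sref j) i = (c < a)%N by rewrite /posdes !pd.
  have Ejj : posdes (z * sref j) j = (b < c)%N by rewrite /posdes !pd.
  have Eiji : posdes (z * sref i * sref j) i = (c < b)%N by rewrite /posdes !pd.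
  have Ejij : posdes (z * sref j * sref i) j = (b < a)%N by rewrite /posdes !pd.
  have Eijj : posdes (z * sref i * sref j) j = (a < c)%N by rewrite /posdes !pd.
  have Ejii : posdes (z * sref j * sref i) i = (a < c)%N by rewrite /posdes !pd.
  clearbody a b c; clear pd sij sji sijl hij.
  have E := (Ei, Ej, Eii, Eij, Eji, Ejj, Eiji, Ejij, Eijj, Ejii).
  have lt3 (p q : 'I_n) : p != q :> nat -> (p < q)%N = ~~ (q < p)%N by lia.
  have := lt3 _ _ nab; have := lt3 _ _ nac; have := lt3 _ _ nbc.
  have T1 : (b < a)%N -> (c < b)%N -> (c < a)%N by lia.
  have T2 : ~~ (b < a)%N -> ~~ (c < b)%N -> ~~ (c < a)%N by lia.
  have xi := up _ i xz; have xj := up _ j xz.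
  rewrite Ei in xi; rewrite Ej in xj.
  have xij : ~~ (b < a)%N -> ~~ (c < a)%N -> weakL x (z * sref i * sref j)%g.
    by move=> h1 h2; rewrite up ?Eij // xi.
  have xji : ~~ (c < b)%N -> ~~ (c < a)%N -> weakL x (z * sref j * sref i)%g.
    by move=> h1 h2; rewrite up ?Eji // xj.
  move: T1 T2 xi xj xij xji.
  case ba: (b < a)%N; case ca: (c < a)%N; case cb: (c < b)%N => //=;
    try (by move=> /(_ isT isT)); try (by move=> _ /(_ isT isT));
    move=> _ _ xi xj xij xji ebc eac eab;
    do 6 ?[rewrite im_op_up;
           last by [exact: xz | exact: xi | exact: xj | exact: xij | exact: xji];
           rewrite ?(E, eab, eac, ebc, ba, ca, cb) /= ?im_opN ?opprK];
    by rewrite ?braid.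
- have silo : sref i (ord_lo j) = ord_lo j.
    by apply: val_inj; rewrite /= sref_val /=; do !case: eqP => //=; lia.
  have sihi : sref i (ord_hi j) = ord_hi j.
    by apply: val_inj; rewrite /= sref_val /=; do !case: eqP => //=; lia.
  have sjlo : sref j (ord_lo i) = ord_lo i.
    by apply: val_inj; rewrite /= sref_val /=; do !case: eqP => //=; lia.
  have sjhi : sref j (ord_hi i) = ord_hi i.
    by apply: val_inj; rewrite /= sref_val /=; do !case: eqP => //=; lia.
  have comm : (z * sref i * sref j)%g = (z * sref j * sref i)%g.
    rewrite -!mulgA; congr (_ * _)%g; apply/permP => k; rewrite !permM.
    by apply: val_inj; rewrite /= !sref_val; do !case: eqP => //=; lia.
  have Eij : posdes (z * sref i) j = posdes z j.
    by rewrite /posdes !pos_sref silo sihi.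
  have Eji : posdes (z * sref j) i = posdes z i.
    by rewrite /posdes !pos_sref sjlo sjhi.
  have := up z i xz; have := up z j xz.
  case di: (posdes z i); case dj: (posdes z j) => xj xi;
    do 4 ?[rewrite im_op_up; last by [exact: xz | exact: xi | exact: xj];
           rewrite ?(Eij, Eji, di, dj) /= ?im_opN ?opprK];
    by rewrite ?comm.
Qed.

End IntervalModule.

(* The H_n(0)-module of the interval [x, y]_L; it is zero when the interval   *)
(* is empty.                                                                  *)
Definition interval_module (F : fieldType) n (x y : 'S_n) : Type :=
  {ffun {z | z \in weakL_interval x y} -> F^o}.

Section IntervalModuleTheory.
Variables (F : fieldType) (n : nat) (x y : 'S_n).
Local Notation M := (interval_module F x y).

HB.instance Definition _ := GRing.Zmodule.on M.

Definition im_scale (h : hecke0 F n) (v : M) : M := pa_act (@im_op F n x y) h v.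

Lemma im_scaleA g h (v : M) : im_scale g (im_scale h v) = im_scale (g * h) v.
Proof. exact: pa_actA (@im_op_lin F n x y) (@im_rel F n x y) g h v. Qed.

Lemma im_scale1 : left_id 1 im_scale.
Proof. exact: pa_act1 (@im_op_lin F n x y) (@im_rel F n x y). Qed.

Lemma im_scaleDr : right_distributive im_scale +%R.
Proof. exact: pa_actDr (@im_op_lin F n x y) (@im_rel F n x y). Qed.

Lemma im_scaleDl v : {morph im_scale^~ v : g h / g + h}.
Proof. exact: pa_actDl (@im_op_lin F n x y) (@im_rel F n x y) v. Qed.

HB.instance Definition _ := GRing.Zmodule_isLmodule.Build (hecke0 F n) M
  im_scaleA im_scale1 im_scaleDr im_scaleDl.

Definition im_basis (z : 'S_n) : M := im_elt F x y z.

(* The scalars of F act through F -> H_n(0) as on functions. *)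
Lemma im_scalar a (v : M) : (a%:A : hecke0 F n) *: v = [ffun u => a * v u].
Proof.
rewrite -[a%:A]/(pa_scale a (pa_class _ (Cst 1))) pa_scaleE.
rewrite -[_ *: _]/(pa_act _ _ _) pa_actE; [|exact: im_op_lin|exact: im_rel].
by rewrite /= scale1r; apply/ffunP => u; rewrite !ffunE.
Qed.

Lemma im_genE i z : z \in weakL_interval x y ->
  hecke0_gen F i *: im_basis z =
    if i \in DesL z then - im_basis z
    else if (z * sref i)%g \in weakL_interval x y then im_basis (z * sref i)%g
    else 0.
Proof.
move=> zI; rewrite -[_ *: _]/(pa_act _ _ _) pa_actE;
  [|exact: im_op_lin|exact: im_rel].
exact: im_op_elt.
Qed.

End IntervalModuleTheory.

Definition indecomposable (R : pzRingType) (M : lmodType R) : Prop :=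
  (exists v : M, v != 0) /\
  forall U W : {pred M}, GRing.submod_closed U -> GRing.submod_closed W ->
    (forall v : M, exists2 u, u \in U & exists2 w, w \in W & v = u + w) ->
    (forall v : M, v \in U -> v \in W -> v = 0) ->
    (forall v : M, v \in U -> v = 0) \/ (forall v : M, v \in W -> v = 0).

Definition is_composition (n : nat) (alpha : seq nat) : bool :=
  all (fun a => 0 < a)%N alpha && (sumn alpha == n).

Definition is_peak_composition (n : nat) (alpha : seq nat) : Prop :=
  is_composition n alpha /\
  forall i, (i.+1 < size alpha)%N -> nth 0%N alpha i != 1%N.

Definition comp_set n (alpha : seq nat) : {set 'I_n.-1} :=
  [set i : 'I_n.-1 |
     i.+1 \in [seq sumn (take k alpha) | k <- iota 1 (size alpha).-1]].

(* Boxes (r, c) of the composition diagram, both coordinates from 0 and rows  *)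
(* from the bottom, listed top row first, left to right.                      *)
Definition diagram (alpha : seq nat) : seq (nat * nat) :=
  [seq (r, c) | r <- rev (iota 0 (size alpha)), c <- iota 0 (nth 0%N alpha r)].

Section Filling.
Variables (n : nat) (alpha : seq nat).

(* For a peak composition the rows with a second box are the bottom size alpha *)
(* or size alpha - 1 ones, so column 2 gets the first even numbers in order.   *)
Definition filling12 (b : nat * nat) : nat :=
  if b.2 == 0%N then b.1.*2.+1 else b.1.+1.*2.

Definition boxes12 : seq (nat * nat) := [seq b <- diagram alpha | (b.2 < 2)%N].
Definition boxes3 : seq (nat * nat) := [seq b <- diagram alpha | (2 <= b.2)%N].

Definition remaining : seq nat :=
  [seq k <- iota 1 n | k \notin [seq filling12 b | b <- boxes12]].

Definition filling (b : nat * nat) : nat :=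
  if (b.2 < 2)%N then filling12 b else nth 0%N remaining (index b boxes3).

Definition reading_word : seq nat := [seq filling b | b <- diagram alpha].

End Filling.

(* Read as one-line notation; the default 1 is never reached on the words     *)
(* used here, see [reading_word_perm].                                        *)
Definition perm_of_word n (w : seq nat) : 'S_n :=
  odflt 1%g [pick s : 'S_n | [forall k : 'I_n, (s k).+1 == nth 0%N w k]].

Lemma mem_diagram alpha b :
  (b \in diagram alpha) = (b.1 < size alpha)%N && (b.2 < nth 0%N alpha b.1)%N.
Proof.
case: b => r c /=; apply/allpairsPdep/andP => [[r' [c' [hr hc [-> ->]]]]|[hr hc]].
  by move: hr hc; rewrite mem_rev !mem_iota.
by exists r, c; rewrite mem_rev !mem_iota.
Qed.

Lemma diagram_uniq alpha : uniq (diagram alpha).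
Proof.
apply: allpairs_uniq_dep => [|r _|[r c] [r' c'] _ _ /= [-> ->] //].
  by rewrite rev_uniq iota_uniq.
exact: iota_uniq.
Qed.

Lemma size_diagram alpha : size (diagram alpha) = sumn alpha.
Proof.
rewrite /diagram size_allpairs_dep map_rev sumn_rev.
rewrite -[in RHS](mkseq_nth 0%N alpha); congr sumn.
by apply: eq_map => r /=; rewrite size_iota.
Qed.

Lemma reading_word_perm n alpha : is_peak_composition n alpha ->
  perm_eq (reading_word n alpha) (iota 1 n).
Proof.
move=> [/andP [/allP pos /eqP sum_n] peak].
set v12 := [seq filling12 b | b <- boxes12 alpha].
have v12_uniq : uniq v12.
  rewrite map_inj_in_uniq ?filter_uniq ?diagram_uniq // => -[r c] [r' c'].
  rewrite !mem_filter /= /filling12 => /andP [hc _] /andP [hc' _] /=.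
  by case: c c' hc hc' => [|[|//]] [|[|//]] _ _ /= h; congr pair; lia.
have v12_sub : {subset v12 <= iota 1 n}.
  move=> _ /mapP [[r c] + ->]; rewrite mem_filter mem_diagram mem_iota /=.
  move=> /and3P [hc hr hca].
  have h2 k : (k < size alpha)%N -> (k.*2 <= sumn (take k alpha))%N.
    elim: k => [//|k IH] hk; rewrite (take_nth 0%N) ?(ltnW hk) // sumn_rcons.
    have := IH (ltnW hk); have := peak k hk.
    have /= := pos _ (mem_nth 0%N (ltnW hk)); lia.
  have := h2 r hr; have : (sumn (take r.+1 alpha) <= n)%N.
    by rewrite -sum_n -{2}[alpha](cat_take_drop r.+1) sumn_cat leq_addr.
  rewrite (take_nth 0%N) // sumn_rcons /filling12 /=.
  by case: c hc hca => [|[|//]] _ /=; lia.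
have perm_v : perm_eq (v12 ++ remaining n alpha) (iota 1 n).
  apply: uniq_perm; rewrite ?iota_uniq //.
    rewrite cat_uniq v12_uniq filter_uniq ?iota_uniq // andbT /=.
    by apply/hasPn => k; rewrite mem_filter => /andP [].
  move=> k; rewrite mem_cat mem_filter -/v12.
  by have [/v12_sub|] := boolP (k \in v12).
have perm_d : perm_eq (boxes12 alpha ++ boxes3 alpha) (diagram alpha).
  have -> : boxes3 alpha = [seq b <- diagram alpha | predC (fun b => b.2 < 2)%N b].
    by apply: eq_filter => b /=; rewrite leqNgt.
  exact/permEl/perm_filterC.
have size3 : size (remaining n alpha) = size (boxes3 alpha).
  have := perm_size perm_v; have := perm_size perm_d.
  by rewrite !size_cat size_diagram sum_n size_iota /v12 size_map => <- /addnI.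
apply: perm_trans perm_v.
rewrite perm_sym in perm_d; apply: perm_trans (perm_map _ perm_d) _.
rewrite map_cat; suff [-> ->] : [seq filling n alpha b | b <- boxes12 alpha] = v12 /\
    [seq filling n alpha b | b <- boxes3 alpha] = remaining n alpha by [].
split; first by apply/eq_in_map => b; rewrite mem_filter /filling => /andP [->].
rewrite -[RHS](mkseq_nth 0%N) size3.
have b3_uniq : uniq (boxes3 alpha) by rewrite filter_uniq ?diagram_uniq.
apply: (@eq_from_nth _ 0%N); rewrite ?size_mkseq ?size_map // => k hk.
rewrite nth_mkseq // (nth_map (0%N, 0%N)) // /filling index_uniq //.
by have := mem_nth (0%N, 0%N) hk; rewrite mem_filter => /andP []; rewrite leqNgt => /negPf ->.
Qed.

Lemma perm_of_wordE n (w : seq nat) (k : 'I_n) :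
  perm_eq w (iota 1 n) -> (perm_of_word n w k).+1 = nth 0%N w k.
Proof.
move=> hw; rewrite /perm_of_word; case: pickP => [s /forallP /(_ k) /eqP //|none].
have sz : size w = n by rewrite (perm_size hw) size_iota.
have w_in (i : 'I_n) : (0 < nth 0%N w i <= n)%N.
  have : nth 0%N w i \in w by rewrite mem_nth ?sz.
  by rewrite (perm_mem hw) mem_iota; lia.
have lt_f (i : 'I_n) : ((nth 0%N w i).-1 < n)%N by have := w_in i; lia.
have f_inj : injective (fun i => Ordinal (lt_f i)).
  move=> i j /(congr1 val) /= eij; apply/val_inj/eqP => /=.
  have -> : (i == j :> nat) = (nth 0%N w i == nth 0%N w j).
    by rewrite nth_uniq ?sz // (perm_uniq hw) iota_uniq.
  by have := w_in i; have := w_in j; lia.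
have /forallP [] := none (perm f_inj) => i.
by rewrite permE /=; have := w_in i; lia.
Qed.

Definition wLT n (alpha : seq nat) : 'S_n := perm_of_word n (reading_word n alpha).

Lemma wLTE n alpha (k : 'I_n) : is_peak_composition n alpha ->
  (wLT n alpha k).+1 = nth 0%N (reading_word n alpha) k.
Proof. by move=> /reading_word_perm /perm_of_wordE. Qed.

Definition Qr (F : fieldType) n (alpha : seq nat) : lmodType (hecke0 F n) :=
  interval_module F (wLT n alpha) (w1 (comp_set n (rev alpha))).

(* Main.v *)
(* Let x be the bottom of the interval.  The basis vector e_x generates the  *)
(* module, so a decomposition e_x = u + w into components of complementary    *)
(* submodules reduces the claim to showing that u is a scalar multiple of e_x; *)
(* and every h killing e_x also kills u.                                      *)
(*   The interval consists of the permutations whose inversion set contains   *)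
(* that of x and which increase along each row.  If some z <> x occurs in u,  *)
(* take one of maximal length, and the least value j that z and x place at    *)
(* different positions, P in x and Q in z.  Then P is read before Q and in    *)
(* another row.  Were P the first box of its row, j - 1 would be a left       *)
(* descent of x, hence of z, which the position of Q forbids.  Otherwise let  *)
(* p be the value that x has just left of P.  Then pi_p ... pi_(j-1) kills    *)
(* e_x (its last step would swap adjacent entries of a row) but moves z up    *)
(* inside the interval, and the maximality of the length of z prevents any    *)
(* cancellation: a contradiction.                                             *)

Require Import Defs.
From mathcomp Require Import all_boot all_order all_algebra all_fingroup.
From mathcomp Require Import zify.
From mathcomp Require Import reals complex.

Set Implicit Arguments.
Unset Strict Implicit.
Unset Printing Implicit Defensive.

Import GRing.Theory.

Local Open Scope ring_scope.

(** The proof is a criterion for intervals plus a check on fillings. By [weakL_invset] the left weak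
    order is inclusion of inversion sets, and by [invset_w1] the top of the interval inverts exactly
    the pairs of positions in different rows. So an upward step from a member stays inside exactly
    when it swaps entries of different rows ([up_in_interval], [up_notin_interval]). The criterion
    [interval_indecomposable] rests on [annihilated_eq0]: a vector without e_x-term that is killed
    by the annihilator of e_x vanishes. Against a nonzero such vector one uses either a left descent
    of x, or a word that kills e_x ([foldr_opn_row0]) but not the vector ([foldr_opn_neq0]). All
    that is asked of x is [x_row], [x_gap] and [x_start]. They hold because, with values counted
    from 0, box (r, c) of the first two columns contains 2r + c, while the other boxes are filled in
    reading order with larger values. The peak condition gives every row below the top one a second
    box. *)

(** * Left weak order by inversion sets *)

Section WeakOrder.
Variable n : nat.
Implicit Types (x y z : 'S_n) (i : 'I_n.-1) (p q : 'I_n).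

Lemma in_invset z p q : ((p, q) \in invset z) = (p < q)%N && (z q < z p)%N.
Proof. by rewrite inE. Qed.

Lemma permV_eq z p q : (z^-1%g p == q) = (p == z q).
Proof. by rewrite -(inj_eq (@perm_inj _ z)) permKV. Qed.

(** Exchanging the values [i] and [i.+1] changes the relative order of no other pair of
    positions. *)
Lemma invset_up x i : ~~ posdes x i ->
  invset (x * sref i)%g = (x^-1%g (ord_lo i), x^-1%g (ord_hi i)) |: invset x.
Proof.
move=> nd; apply/setP => -[p q]; rewrite in_setU1 !in_invset !permM !sref_val.
rewrite xpair_eqE ![_ == x^-1%g _]eq_sym !permV_eq -!val_eqE /=.
have /= := nd; rewrite /posdes -leqNgt leq_eqVlt (inj_eq val_inj).
rewrite (inj_eq perm_inj) -val_eqE /= => /orP [/eqP|]; first by lia.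
set a := x^-1%g (ord_lo i); set b := x^-1%g (ord_hi i) => lab.
have xa : x a = i :> nat by rewrite permKV.
have xb : x b = i.+1 :> nat by rewrite permKV.
have xaP r : (x r == i :> nat) = (r == a) by rewrite -xa val_eqE (inj_eq perm_inj).
have xbP r : (x r == i.+1 :> nat) = (r == b) by rewrite -xb val_eqE (inj_eq perm_inj).
have xpq : (x p == x q :> nat) = (p == q) by rewrite val_eqE (inj_eq perm_inj).
rewrite ![i == _ :> nat]eq_sym ![i.+1 == _ :> nat]eq_sym.
move: (xaP p) (xaP q) (xbP p) (xbP q) xpq; rewrite -!val_eqE.
by clearbody a b; do !case: eqP => //=; lia.
Qed.

Lemma length_up x i : ~~ posdes x i ->
  coxeter_length (x * sref i)%g = (coxeter_length x).+1.
Proof. by move=> nd; rewrite !coxeter_lengthE invset_sref. Qed.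

Lemma weakL_ind x (P : 'S_n -> Prop) : P x ->
    (forall z i, weakL x z -> P z -> ~~ posdes z i -> P (z * sref i)%g) ->
  forall z, weakL x z -> P z.
Proof.
move=> Px Pstep z /connectP [s + ->]; elim/last_ind: s => [|s t IH] //=.
rewrite rcons_path last_rcons => /andP [xs /existsP [i /andP [+ /eqP ->]]].
rewrite in_DesL => nd; apply: Pstep (IH xs) nd.
by apply/connectP; exists s.
Qed.

Lemma weakL_refl x : weakL x x.
Proof. exact: connect0. Qed.

Lemma weakL_up x z i : weakL x z -> ~~ posdes z i -> weakL x (z * sref i)%g.
Proof. by move=> xz /weakL_step; apply: connect_trans. Qed.

(** For the converse, climb from [x] by an ascent whose two positions [z] inverts. If there is none,
    the map sending each value of [x] to the value of [z] at the same position has no descent, so it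
    is the identity. *)
Lemma weakL_invset x z : weakL x z = (invset x \subset invset z).
Proof.
apply/idP/idP => [|sub].
  move: z; apply: weakL_ind => // z i _ xz nd.
  by rewrite invset_up // (subset_trans xz) // subsetUr.
have [m] := ubnP #|invset z :\: invset x|; elim: m x sub => // m IH x sub le_m.
have [/existsP [i /andP [nd zi]]|none] := boolP [exists i : 'I_n.-1, ~~ posdes x i
    && (z (x^-1%g (ord_hi i)) < z (x^-1%g (ord_lo i)))%N].
  apply: connect_trans (weakL_step nd) _.
  have new : (x^-1%g (ord_lo i), x^-1%g (ord_hi i)) \in invset z :\: invset x.
    rewrite in_setD !in_invset zi !permKV /= [(i.+1 < i)%N]ltnNge leqnSn andbF andbT /=.
    move: nd; rewrite /posdes -leqNgt leq_eqVlt (inj_eq val_inj).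
    by rewrite (inj_eq perm_inj) -val_eqE /=; lia.
  apply: IH; rewrite invset_up //.
    by rewrite subUset sub1set sub andbT; move: new; rewrite inE => /andP [].
  by move: le_m; rewrite (cardsD1 (x^-1%g (ord_lo i), x^-1%g (ord_hi i)) (_ :\: _)) new setDDl setUC.
suff <- : x = z by apply: weakL_refl.
have : (z^-1 * x)%g = 1%g.
  apply: nodes_id => i; rewrite /posdes invMg invgK !permM -leqNgt.
  have [des|nd] := boolP (posdes x i); last first.
    by have := existsPn none i; rewrite nd /= -leqNgt.
  have := subsetP sub (x^-1%g (ord_hi i), x^-1%g (ord_lo i)).
  by rewrite !in_invset !permKV (des : (_ < _)%N) ltnSn => /(_ isT) /andP [_ /ltnW].
by move/(congr1 (mulg z)); rewrite mulKVg mulg1.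
Qed.

End WeakOrder.

(** * The longest permutation with right descents in a given set *)

Section Blocks.
Variables (n : nat) (S : {set 'I_n.-1}) (rho : 'I_n -> nat).
Hypothesis rho_mono : forall p q : 'I_n, (p <= q)%N -> (rho p <= rho q)%N.
Hypothesis rho_S : forall i, (i \in S) = (rho (ord_lo i) != rho (ord_hi i)).
Implicit Types (z : 'S_n) (i : 'I_n.-1) (p q : 'I_n).

Lemma in_DesR z i : (i \in DesR z) = (z (ord_hi i) < z (ord_lo i))%N.
Proof.
have invC (g : 'S_n) : #|invset g^-1%g| = #|invset g|.
  pose f (p : 'I_n * 'I_n) := (g p.2, g p.1).
  have f_inj : injective f by move=> [a b] [c d] [/perm_inj -> /perm_inj ->].
  rewrite -[RHS](card_imset _ f_inj); apply: eq_card => -[a b].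
  apply/idP/imsetP => [|[[c d] + [-> ->]]]; rewrite !in_invset.
    move=> /andP [ab gab]; exists (g^-1%g b, g^-1%g a); rewrite /f ?permKV //=.
    by rewrite in_invset !permKV gab ab.
  by rewrite !permK /= andbC.
have := in_DesL z^-1%g i; rewrite !inE !coxeter_lengthE /posdes !invgK => <-.
rewrite !invC -(invC (_ * z)%g) -(invC z) invMg tpermV.
by congr (#|invset (_ * _)%g| < _)%N.
Qed.

Lemma DesR_subP z : reflect
  (forall p q, (p < q)%N -> rho p = rho q -> (z p < z q)%N) (DesR z \subset S).
Proof.
apply: (iffP subsetP) => [sub p q|incr i]; last first.
  rewrite in_DesR rho_S; apply: contraTneq => /incr -/(_ _)/ltnW.
  by rewrite -leqNgt; apply.
have step (a b : 'I_n) : b = a.+1 :> nat -> rho a = rho b -> (z a < z b)%N.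
  move=> eab rab; have lt_a : (a < n.-1)%N by have := ltn_ord b; lia.
  have := sub (Ordinal lt_a); rewrite in_DesR rho_S.
  have -> : ord_lo (Ordinal lt_a) = a by apply: val_inj.
  have -> : ord_hi (Ordinal lt_a) = b by apply: val_inj; rewrite /= eab.
  rewrite rab eqxx ltnNge leq_eqVlt => h; case: ltngtP h => //.
    by move=> _ /(_ isT).
  by move=> /val_inj/perm_inj ab; move: eab; rewrite ab; lia.
have [m] := ubnP (q - p); elim: m q => // m IH q le_m lt_pq rpq.
have lt_c : (q.-1 < n)%N by have := ltn_ord q; lia.
have [eqp|neq] := eqVneq q.-1 (p : nat); first by apply: step => //; lia.
have := @rho_mono p (Ordinal lt_c); have := @rho_mono (Ordinal lt_c) q.
move=> /(_ (leq_pred _)) r1 /(_ _) r2.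
have rc : rho p = rho (Ordinal lt_c).
  by apply/eqP; rewrite eqn_leq {2}rpq r1 andbT; apply: r2 => /=; lia.
apply: (@ltn_trans (z (Ordinal lt_c))).
  by apply: IH => //=; lia.
by apply: step => /=; [lia | rewrite -rc].
Qed.

(** Let [y] be longest. If [i] stood in an earlier block than [i.+1], exchanging them would give a
    longer permutation that still increases on blocks. Hence the block number weakly decreases as
    the value grows. *)
Lemma invset_w1 :
  invset (w1 S) = [set p : 'I_n * 'I_n | (p.1 < p.2)%N && (rho p.1 != rho p.2)].
Proof.
rewrite /w1; case: arg_maxnP => [|y /DesR_subP incr maxy].
  by apply/DesR_subP => p q; rewrite !perm1.
apply/setP => -[p q]; rewrite in_invset inE /=; apply: andb_id2l => lt_pq.
have [/incr|npq] := eqVneq (rho p) (rho q).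
  by move=> /(_ lt_pq); case: ltngtP.
have step i : (rho (y^-1%g (ord_hi i)) <= rho (y^-1%g (ord_lo i)))%N.
  rewrite leqNgt; apply/negP => lt_rho.
  have lt_pos : (y^-1%g (ord_lo i) < y^-1%g (ord_hi i))%N.
    by rewrite ltnNge; apply/negP => /rho_mono; rewrite leqNgt lt_rho.
  have nd : ~~ posdes y i by rewrite /posdes -leqNgt ltnW.
  have := maxy (y * sref i)%g; rewrite /= length_up // => max_i.
  suff /max_i : DesR (y * sref i)%g \subset S by rewrite /= ltnn.
  apply/DesR_subP => a b lab rab; have := incr a b lab rab.
  rewrite !permM !sref_val.
  have [ya|] := eqVneq (y a : nat) i.
    have ea : y^-1%g (ord_lo i) = a.
      by apply/eqP; rewrite permV_eq -val_eqE /= ya.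
    have [yb|] := eqVneq (y b : nat) i.+1.
      have eb : y^-1%g (ord_hi i) = b.
        by apply/eqP; rewrite permV_eq -val_eqE /= yb.
      by move: lt_rho; rewrite ea eb rab ltnn.
    by do !case: eqP => //=; lia.
  by do !case: eqP => //=; lia.
have mono d : forall a b : 'I_n, b = (a + d)%N :> nat ->
    (rho (y^-1%g b) <= rho (y^-1%g a))%N.
  elim: d => [|d IH] a b eab.
    by rewrite (_ : a = b) //; apply: val_inj; rewrite /= eab addn0.
  have lt_c : (a + d < n.-1)%N by have := ltn_ord b; lia.
  have := step (Ordinal lt_c).
  have -> : ord_hi (Ordinal lt_c) = b by apply: val_inj; rewrite /= eab addnS.
  by move/leq_trans; apply; apply: IH.
rewrite ltnNge; apply: contraNN npq => le_y.
have := mono (y q - y p)%N (y p) (y q); rewrite subnKC // !permK.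
move=> /(_ erefl); have := rho_mono (ltnW lt_pq).
by rewrite eqn_leq => -> ->.
Qed.

End Blocks.

(** * Interval modules *)

Section IntervalOperators.
Variables (F : fieldType) (n : nat) (x y : 'S_n).
Local Notation M := (interval_module F x y).
Local Notation I := (weakL_interval x y).
Local Notation op := (@im_op F n x y).
Local Notation basis := (im_basis F x y).
Implicit Types (v : M) (z w : 'S_n) (i : 'I_n.-1).

Lemma gen_scaleE i v : hecke0_gen F i *: v = op i v.
Proof.
by rewrite -[_ *: _]/(pa_act _ _ _) pa_actE; [|exact: im_op_lin|exact: im_rel].
Qed.

(** Writing the coefficient as a sum extends it by 0 to all permutations, so no membership proof has
    to be carried. *)
Definition bcoef v z : F := \sum_(u : {z | z \in I}) v u * (val u == z)%:R.

Lemma bcoef_val v (u : {z | z \in I}) : bcoef v (val u) = v u.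
Proof.
rewrite /bcoef (bigD1 u) //= eqxx mulr1 big1 ?addr0 // => t.
by rewrite -val_eqE => /negPf ->; rewrite mulr0.
Qed.

Lemma bcoef_out v z : z \notin I -> bcoef v z = 0.
Proof.
move=> zI; apply: big1 => u _; case: eqP => [uz|]; last by rewrite mulr0.
by move: zI; rewrite -uz (valP u).
Qed.

Lemma bcoef_eq0 v : (forall z, bcoef v z = 0) -> v = 0.
Proof. by move=> v0; apply/ffunP => u; rewrite -bcoef_val v0 ffunE. Qed.

Lemma bcoefB v v' z : bcoef (v - v') z = bcoef v z - bcoef v' z.
Proof.
rewrite /bcoef -sumrB; apply: eq_bigr => u _.
by rewrite !ffunE mulrBl.
Qed.

Lemma bcoefN v z : bcoef (- v) z = - bcoef v z.
Proof. by rewrite -sumrN; apply: eq_bigr => u _; rewrite !ffunE mulNr. Qed.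

Lemma bcoef0 z : bcoef 0 z = 0.
Proof. by apply: big1 => u _; rewrite ffunE mul0r. Qed.

Lemma bcoefZ a v z : bcoef ((a%:A : hecke0 F n) *: v) z = a * bcoef v z.
Proof.
by rewrite mulr_sumr im_scalar; apply: eq_bigr => u _; rewrite ffunE mulrA.
Qed.

Lemma bcoef_basis z : z \in I -> bcoef (basis z) z = 1.
Proof.
by move=> zI; have /= -> := bcoef_val (basis z) (exist _ z zI); rewrite ffunE eqxx.
Qed.

(** The basis element at [w] arises only from itself, with sign -1, when [i] is a descent of [w],
    and from the element that [w] covers through [i]. *)
Lemma bcoef_op i v w : w \in I ->
  bcoef (op i v) w = if posdes w i then bcoef v (w * sref i)%g - bcoef v w else 0.
Proof.
move=> wI; have /= -> := bcoef_val (op i v) (exist _ w wI).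
rewrite /im_op sum_ffunE; set u0 := exist _ w wI.
have star (u : {z | z \in I}) : (v u *: im_star F x y i (val u)) u0 =
    if posdes w i then v u * (val u == w * sref i)%g%:R - v u * (val u == w)%:R
    else 0.
  rewrite ffunE /im_star in_DesL -[_ *: _]/(v u * _) -mulrBr.
  have nws : (w == w * sref i)%g = false.
    by apply/eqP => /(congr1 (@posdes n ^~ i)); rewrite posdes_sref; case: posdes.
  have [->|nuw] := eqVneq (val u) w.
    rewrite nws.
    case: (posdes w i); first by rewrite !ffunE /= eqxx add0r.
    case: ifP => _; rewrite !ffunE ?mulr0 //=.
    by rewrite nws mulr0.
  rewrite subr0.
  have [uws|nuws] := eqVneq (val u) (w * sref i)%g.
    rewrite uws srefKr posdes_sref wI.
    case: (posdes w i); rewrite /= !ffunE /= ?eqxx //.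
    by rewrite nws oppr0 mulr0.
  rewrite mulr0 if_same; case: ifP => _; first by rewrite !ffunE /= eq_sym (negPf nuw) oppr0 mulr0.
  case: ifP => _; rewrite !ffunE ?mulr0 //= (_ : _ == _ = false) ?mulr0 //.
  by apply: contraNF nuws => /eqP ->; rewrite srefKr.
rewrite (eq_bigr _ (fun u _ => star u)); case: (posdes w i); last by rewrite big1.
by rewrite sumrB.
Qed.

Lemma basis_out z : z \notin I -> basis z = 0.
Proof. exact: im_elt_out. Qed.

Lemma op_basis i z : weakL x z ->
  op i (basis z) = if posdes z i then - basis z else basis (z * sref i)%g.
Proof. exact: im_op_up. Qed.

(* The operator of index [k], extended by the identity out of range, so that  *)
(* words can be taken in [nat]. *)
Definition opn (k : nat) v : M := if insub k is Some i then op i v else v.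

Lemma opnE i v : opn i v = op i v.
Proof. by rewrite /opn valK. Qed.

Lemma word_scaleE (s : seq nat) :
  exists h : hecke0 F n, forall v, h *: v = foldr opn v s.
Proof.
elim: s => [|k s [h IH]] /=; first by exists 1 => v; rewrite scale1r.
rewrite /opn; case: insubP => [i _ _|_]; last by exists h.
by exists (hecke0_gen F i * h) => v; rewrite -scalerA IH gen_scaleE.
Qed.

(** The last letter acts first: when every step goes up, the word [iota p d.+1] carries the value
    [p + d.+1] down to [p], one unit at a time. *)
Lemma foldr_iotaS v p d :
  foldr opn v (iota p d.+1) = foldr opn (opn (p + d) v) (iota p d).
Proof. by rewrite -addn1 iotaD foldr_cat. Qed.

Lemma submod_basis (U : {pred M}) : GRing.submod_closed U ->
  basis x \in U -> forall v, v \in U.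
Proof.
move=> [U0 Ulin] Ux v.
have UZ h u : u \in U -> h *: u \in U.
  by move=> Uu; rewrite -[_ *: _]addr0 Ulin.
(* The induction may run over everything above [x]: outside the interval [basis z] is 0. *)
have Uz z : weakL x z -> basis z \in U.
  move: z; apply: weakL_ind => // z i xz Uz nd.
  have := op_basis i xz; rewrite (negPf nd) => <-.
  by rewrite -gen_scaleE UZ.
rewrite [v]im_expand; elim/big_rec: _ => // u s _ Us.
have -> : v u *: im_elt F x y (val u) =
    ((v u : F)%:A : hecke0 F n) *: basis (val u) :> M.
  by rewrite im_scalar; apply/ffunP => t; rewrite !ffunE.
by apply: Ulin => //; apply: Uz; have := valP u; rewrite inE => /andP [].
Qed.

End IntervalOperators.

(** * Terms of maximal length *)

Section TopCoefficient.
Variables (F : fieldType) (n : nat) (x y : 'S_n).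
Local Notation M := (interval_module F x y).
Local Notation I := (weakL_interval x y).
Implicit Types (v : M) (z w : 'S_n) (i : 'I_n.-1).

Definition length_le (L : nat) v :=
  forall w, bcoef v w != 0 -> (coxeter_length w <= L)%N.

(* An operator raises lengths by at most one, so nothing can cancel the image *)
(* of a term of maximal length that goes up. *)
Lemma op_top v z i : length_le (coxeter_length z) v -> ~~ posdes z i ->
    (z * sref i)%g \in I ->
  length_le (coxeter_length (z * sref i)%g) (im_op i v) /\
  bcoef (im_op i v) (z * sref i)%g = bcoef v z.
Proof.
move=> top nd zI; split; last first.
  rewrite bcoef_op // posdes_sref nd srefKr.
  have [->|/top] := eqVneq (bcoef v (z * sref i)%g) 0; first by rewrite subr0.
  by rewrite length_up // ltnn.
move=> w; have [wI|/(bcoef_out (im_op i v)) ->] := boolP (w \in I); last by rewrite eqxx.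
rewrite bcoef_op // length_up //; case: ifP => des; last by rewrite eqxx.
have [->|/top le_w _] := eqVneq (bcoef v (w * sref i)%g) 0.
  by rewrite sub0r oppr_eq0 => /top /leqW.
by rewrite -[w](srefKr _ i) length_up // posdes_sref negbK.
Qed.

End TopCoefficient.

(** * A criterion for indecomposability *)

Section Indecomposable.
Variables (F : fieldType) (n : nat) (x y : 'S_n) (rho : 'I_n -> nat).
Hypothesis rho_mono : forall p q : 'I_n, (p <= q)%N -> (rho p <= rho q)%N.
Hypothesis inv_y :
  invset y = [set p : 'I_n * 'I_n | (p.1 < p.2)%N && (rho p.1 != rho p.2)].
Hypothesis x_row : forall p q : 'I_n, (p < q)%N -> rho p = rho q -> (x p < x q)%N.
(** In [annihilated_eq0], [x_gap] serves when the first misplaced value has a left neighbour in its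
    row, and [x_start] when it begins its row. *)
Hypothesis x_gap : forall p q r : 'I_n, q = p.+1 :> nat -> rho p = rho q ->
  (x p < x r)%N -> (x r < x q)%N -> (r < p)%N.
Hypothesis x_start : forall p q : 'I_n, (p < q)%N -> rho p != rho q ->
  (forall p0 : 'I_n, p = p0.+1 :> nat -> rho p0 != rho p) ->
  exists p' : 'I_n, [/\ (p < p')%N, x p = (x p').+1 :> nat &
    forall q' : 'I_n, (p < q')%N -> (q' < p')%N -> rho p != rho q' ->
      (x q' < x p)%N].
Local Notation M := (interval_module F x y).
Local Notation I := (weakL_interval x y).
Local Notation basis := (im_basis F x y).
Local Notation opn := (@opn F n x y).
Implicit Types (v : M) (z w : 'S_n) (i : 'I_n.-1).

Lemma in_interval z : (z \in I) = weakL x z && weakL z y.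
Proof. by rewrite inE. Qed.

Lemma bottom_in_interval : x \in I.
Proof.
rewrite in_interval weakL_refl weakL_invset inv_y; apply/subsetP => -[p q].
rewrite in_invset inE /= => /andP [lt_pq lt_x]; rewrite lt_pq /=.
by apply: contraTneq lt_x => /(x_row lt_pq); rewrite -leqNgt; apply: ltnW.
Qed.

Lemma up_in_interval z i : z \in I -> ~~ posdes z i ->
  rho (z^-1%g (ord_lo i)) != rho (z^-1%g (ord_hi i)) -> (z * sref i)%g \in I.
Proof.
rewrite !in_interval => /andP [xz zy] nd rz; rewrite weakL_up //=.
move: zy; rewrite !weakL_invset invset_up // subUset sub1set => ->.
rewrite inv_y inE rz !andbT /= ltn_neqAle val_eqE (inj_eq perm_inj) -val_eqE /=.
by rewrite leqNgt nd andbT; lia.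
Qed.

Lemma up_notin_interval z i :  ~~ posdes z i ->
  rho (z^-1%g (ord_lo i)) = rho (z^-1%g (ord_hi i)) -> (z * sref i)%g \notin I.
Proof.
move=> nd rz; rewrite in_interval negb_and orbC weakL_invset invset_up //.
by rewrite subUset sub1set inv_y inE /= rz eqxx andbF.
Qed.

Lemma sref_perm_hi z i (q : 'I_n) : z q = i.+1 :> nat -> z^-1%g (ord_hi i) = q.
Proof. by move=> zq; apply/eqP; rewrite permV_eq -val_eqE /= zq. Qed.

Lemma sref_perm_lo z i (q : 'I_n) : z q = i :> nat -> z^-1%g (ord_lo i) = q.
Proof. by move=> zq; apply/eqP; rewrite permV_eq -val_eqE /= zq. Qed.

(* Moving the value [p + d] of [x] down to [p] fails in its last step, which  *)
(* would create an inversion inside a row. *)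
Lemma foldr_opn_row0 d : forall z (a b : 'I_n) p,
    weakL x z -> (a < b)%N -> rho a = rho b -> z a = p :> nat ->
    z b = (p + d.+1)%N :> nat ->
    (forall r : 'I_n, (p < z r)%N -> (z r < p + d.+1)%N -> (r < b)%N) ->
  foldr opn (basis z) (iota p d.+1) = 0.
Proof.
elim: d => [|d IH] z a b p xz lt_ab rab za zb gap.
  have lt_i : (p < n.-1)%N by have := ltn_ord (z b); lia.
  have ea := @sref_perm_lo z (Ordinal lt_i) a za.
  have eb : z^-1%g (ord_hi (Ordinal lt_i)) = b by apply: sref_perm_hi; rewrite zb addn1.
  have nd : ~~ posdes z (Ordinal lt_i) by rewrite /posdes ea eb -leqNgt ltnW.
  rewrite /= -[p]/(val (Ordinal lt_i)) opnE op_basis // (negPf nd).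
  by rewrite basis_out // up_notin_interval // ea eb.
have lt_i : (p + d.+1 < n.-1)%N by have := ltn_ord (z b); lia.
set i := Ordinal lt_i; set c := z^-1%g (ord_lo i).
have zc : z c = (p + d.+1)%N :> nat by rewrite permKV.
have eb : z^-1%g (ord_hi i) = b by apply: sref_perm_hi; rewrite zb addnS.
have nd : ~~ posdes z i by rewrite /posdes eb -/c -leqNgt ltnW // gap // zc; lia.
rewrite foldr_iotaS -[(p + _)%N]/(val i) opnE op_basis // (negPf nd).
apply: (IH _ a b) => //; first exact: weakL_up.
- by rewrite permM sref_val za /=; do !case: eqP => //=; lia.
- by rewrite permM sref_val zb /=; do !case: eqP => //=; lia.
move=> r; rewrite permM sref_val /=; case: eqP => [|_]; first by lia.
case: eqP => [zr|_ lt_p lt_r]; last by apply: gap; lia.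
by lia.
Qed.

(** Each letter swaps the value at [b] with one placed earlier in another row, so [z] keeps going up
    inside the interval. By [op_top] its coefficient survives unchanged. *)
Lemma foldr_opn_neq0 d : forall v z (b : 'I_n) p,
    z \in I -> length_le (coxeter_length z) v -> bcoef v z != 0 ->
    z b = (p + d)%N :> nat ->
    (forall r : 'I_n, (p <= z r)%N -> (z r < p + d)%N ->
       (r < b)%N && (rho r != rho b)) ->
  foldr opn v (iota p d) != 0.
Proof.
elim: d => [|d IH] v z b p zI top vz zb gap.
  by apply: contraNneq vz => /= ->; rewrite bcoef0.
have lt_i : (p + d < n.-1)%N by have := ltn_ord (z b); lia.
set i := Ordinal lt_i; set c := z^-1%g (ord_lo i).
have zc : z c = (p + d)%N :> nat by rewrite permKV.
have eb : z^-1%g (ord_hi i) = b by apply: sref_perm_hi; rewrite zb addnS.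
have /andP [lt_cb rcb] : (c < b)%N && (rho c != rho b) by apply: gap; lia.
have nd : ~~ posdes z i by rewrite /posdes eb -/c -leqNgt ltnW.
have ziI : (z * sref i)%g \in I by apply: up_in_interval; rewrite ?eb.
have [top' bcoef'] := op_top top nd ziI.
rewrite foldr_iotaS -[(p + _)%N]/(val i) opnE.
apply: (IH _ (z * sref i)%g b) => //; first by rewrite bcoef'.
  by rewrite permM sref_val zb /=; do !case: eqP => //=; lia.
move=> r; rewrite permM sref_val /=; case: eqP => [|_]; first by lia.
by case: eqP => [zr|_ lt_p lt_r]; [lia | apply: gap; lia].
Qed.

Lemma annihilated_eq0 v :
    (forall h : hecke0 F n, h *: basis x = 0 -> h *: v = 0) ->
  bcoef v x = 0 -> v = 0.
Proof.
move=> ann vx0; apply: bcoef_eq0 => z0; apply/eqP/negPn/negP => vz0.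
have [z vz top] := @arg_maxnP _ z0 (fun w => bcoef v w != 0) (@coxeter_length n) vz0.
have nzx : z != x by apply: contraNneq vz => ->; rewrite vx0.
have zI : z \in I by apply: contraNT vz => zI; rewrite bcoef_out.
(* For a descent [i] of [x], the element [hecke0_gen F i + 1] kills e_x, hence [v]. But the image of
   the operator has no term at which [i] is an ascent. *)
have des_z i : posdes x i -> posdes z i.
  move=> des; have := ann (hecke0_gen F i + 1).
  rewrite !scalerDl !scale1r !gen_scaleE op_basis ?weakL_refl // des addNr.
  move=> /(_ erefl) /eqP; rewrite addr_eq0 => /eqP.
  move/(congr1 (fun v => bcoef v z)); rewrite bcoef_op // bcoefN.
  by case: (posdes z i) => // /esym /eqP; rewrite oppr_eq0 (negPf vz).
have sub_xz : invset x \subset invset z.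
  by move: zI; rewrite in_interval -weakL_invset => /andP [].
have sub_zy : invset z \subset invset y.
  by move: zI; rewrite in_interval -!weakL_invset => /andP [].
have [j0 neq_j0] : exists j, z^-1%g j != x^-1%g j.
  apply/existsP; apply: contraNT nzx; rewrite negb_exists => /forallP eq_zx.
  apply/eqP/invg_inj/permP => j; have := eq_zx j; by rewrite negbK => /eqP.
have [j] := @arg_minnP _ j0 (fun j => z^-1%g j != x^-1%g j) (@nat_of_ord n) neq_j0.
set a := x^-1%g j; set b := z^-1%g j => neq_ba minj.
have xa : x a = j by rewrite permKV.
have zb : z b = j by rewrite permKV.
have agree (r : 'I_n) : (x r < j)%N -> z r = x r.
  move=> lt_r; apply/eqP; rewrite eq_sym -permV_eq; apply/eqP.
  have [eq_r|/minj] := eqVneq (z^-1%g (x r)) (x^-1%g (x r)).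
    by rewrite eq_r permK.
  by rewrite leqNgt lt_r.
have agree' (r : 'I_n) : (z r < j)%N -> x r = z r.
  move=> lt_r; apply/eqP; rewrite eq_sym -permV_eq; apply/eqP.
  have [eq_r|/minj] := eqVneq (z^-1%g (z r)) (x^-1%g (z r)).
    by rewrite -eq_r permK.
  by rewrite leqNgt lt_r.
have lt_xb : (j < x b)%N.
  rewrite ltnNge leq_eqVlt -xa val_eqE (inj_eq perm_inj) (negPf neq_ba) /= xa.
  by apply/negP => lt_b; have := agree _ lt_b; rewrite zb => e; rewrite -e ltnn in lt_b.
have lt_za : (j < z a)%N.
  rewrite ltnNge leq_eqVlt -zb val_eqE (inj_eq perm_inj) eq_sym (negPf neq_ba) /= zb.
  by apply/negP => lt_a; have := agree' _ lt_a; rewrite xa => e; rewrite -e ltnn in lt_a.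
(* Otherwise [(b, a)] would be an inversion of [x] but not of [z]. *)
have lt_ab : (a < b)%N.
  case: ltngtP => // [lt_ba|/val_inj eab]; last by rewrite eab eqxx in neq_ba.
  have := subsetP sub_xz (b, a); rewrite !in_invset lt_ba xa lt_xb => /(_ isT).
  by rewrite zb /= ltnNge ltnW.
have rab : rho a != rho b.
  have := subsetP sub_zy (a, b); rewrite in_invset lt_ab zb lt_za => /(_ isT).
  by rewrite inv_y inE => /andP [].
have [/existsP [a0 /andP [/eqP ea0 /eqP ra0]]|start] :=
    boolP [exists a0 : 'I_n, (a == a0.+1 :> nat) && (rho a0 == rho a)].
  have lt_xa0 : (x a0 < j)%N by rewrite -xa x_row // ea0.
  (* The word takes the value [j] down to the value of its left neighbour in [x]. The values passed
     over are below [j], so [x] and [z] place them alike. *)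
  pose d := (j - (x a0).+1)%N; have ej : j = (x a0 + d.+1)%N :> nat by lia.
  have [h hE] := @word_scaleE F n x y (iota (x a0) d.+1).
  suff /eqP : foldr opn v (iota (x a0) d.+1) = 0.
    apply/negP; apply: (@foldr_opn_neq0 _ v z b); rewrite ?zb //.
    move=> r le_r; rewrite -ej => lt_r; have xr := agree' r lt_r.
    rewrite -xr in le_r lt_r.
    have le_ra : (r < a)%N.
      move: le_r; rewrite leq_eqVlt val_eqE (inj_eq perm_inj) => /orP [/eqP <-|lt_a0r].
        by lia.
      by have := x_gap ea0 ra0 lt_a0r; rewrite xa; lia.
    rewrite (ltn_trans le_ra lt_ab); apply: contraNneq rab => rrb.
    by rewrite eqn_leq (rho_mono (ltnW lt_ab)) -rrb (rho_mono (ltnW le_ra)).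
  rewrite -hE ann // hE; apply: (@foldr_opn_row0 _ _ a0 a); rewrite ?weakL_refl ?xa //.
    by lia.
  by move=> r lt_a0r lt_rj; have := x_gap ea0 ra0 lt_a0r; rewrite xa; lia.
have start' (p0 : 'I_n) : a = p0.+1 :> nat -> rho p0 != rho a.
  by move=> e; have := existsPn start p0; rewrite e eqxx.
have [a' [lt_aa' xa' between]] := x_start lt_ab rab start'.
rewrite xa in xa'.
have lt_i : (x a' < n.-1)%N by have := ltn_ord j; lia.
have za' : z a' = x a' by apply: agree; lia.
(* [j - 1] is a left descent of [x], so in [z] the position [b] of [j] precedes [a']. Then [between]
   bounds [x b] by [j], against [lt_xb]. *)
have := des_z (Ordinal lt_i); rewrite /posdes.
rewrite (@sref_perm_lo x _ a') // (@sref_perm_hi x _ a) ?xa //.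
rewrite (@sref_perm_lo z _ a') ?za' // (@sref_perm_hi z _ b) ?zb // lt_aa'.
move=> /(_ isT) lt_ba'; have := between b lt_ab lt_ba' rab.
by rewrite xa ltnNge ltnW.
Qed.

Lemma interval_indecomposable : indecomposable M.
Proof.
have xI := bottom_in_interval.
split.
  exists (basis x); apply/eqP => /(congr1 (fun v => bcoef v x)).
  by rewrite bcoef_basis // bcoef0 => /eqP; rewrite oner_eq0.
move=> U W subU subW sumUW capUW; have [u uU [w wW e_uw]] := sumUW (basis x).
have closed (V : {pred M}) h v : GRing.submod_closed V -> v \in V -> h *: v \in V.
  by move=> [V0 Vlin] vV; rewrite -[_ *: _]addr0 Vlin.
pose c : F := bcoef u x.
have eu : u = (c%:A : hecke0 F n) *: basis x.
  (* If [h] kills e_x then [h *: u = - (h *: w)] lies in both submodules, so it is 0. The multiple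
     of e_x is killed as well, since scalars are central. *)
  apply/eqP; rewrite -subr_eq0; apply/eqP/annihilated_eq0 => [h hx|]; last first.
    by rewrite bcoefB bcoefZ bcoef_basis // mulr1 subrr.
  rewrite scalerBr [_ *: (_ *: basis x)]scalerA -scalerAr mulr1.
  rewrite -[h in X in _ - X]mul1r scalerAl -scalerA hx scaler0 subr0.
  apply: capUW; first exact: closed.
  have -> : h *: u = - (h *: w) by apply/eqP; rewrite -addr_eq0 -scalerDr -e_uw hx.
  by rewrite -scaleN1r scalerA; apply: closed.
have [c0|c_neq0] := eqVneq c 0.
  left => v vU; apply: capUW vU _; apply: (submod_basis subW).
  by rewrite e_uw eu c0 scale0r scale0r add0r.
right => v vW; apply: capUW _ vW; apply: (submod_basis subU).
have -> : basis x = ((c^-1)%:A : hecke0 F n) *: u.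
  by rewrite eu scalerA -scalerAl mul1r scalerA mulVf // !scale1r.
exact: closed.
Qed.

End Indecomposable.

(** * The canonical filling of a peak composition *)

Definition read_before : rel (nat * nat) :=
  fun b b' => (b'.1 < b.1)%N || (b.1 == b'.1) && (b.2 < b'.2)%N.

Lemma read_before_trans : transitive read_before.
Proof. by move=> [r c] [r' c'] [r'' c'']; rewrite /read_before /=; lia. Qed.

Lemma diagram_sorted alpha : sorted read_before (diagram alpha).
Proof.
rewrite sorted_pairwise; last exact: read_before_trans.
rewrite /diagram; set f := fun r => iota 0 (nth 0%N alpha r).
have : sorted gtn (rev (iota 0 (size alpha))) by rewrite rev_sorted iota_ltn_sorted.
elim: (rev _) => //= r rs IH; rewrite (path_sortedE (rev_trans ltn_trans)).
move=> /andP [/allP lt_r /IH {}IH]; rewrite pairwise_cat IH andbT.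
apply/andP; split; last first.
  rewrite pairwise_map -sorted_pairwise; last first.
    by move=> a b c; rewrite /relpre /read_before /=; lia.
  rewrite (eq_sorted (e' := ltn)) ?iota_ltn_sorted // => a b.
  by rewrite /read_before /= ltnn eqxx.
apply/allrelP => _ _ /mapP [c _ ->] /allpairsPdep [r' [c' [/lt_r r'r _ ->]]].
by rewrite /read_before /= (r'r : (_ < _)%N).
Qed.

Section Diagram.
Variables (n : nat) (alpha : seq nat).
Hypothesis alpha_peak : is_peak_composition n alpha.
Local Notation l := (size alpha).
Local Notation box := (nth (0%N, 0%N) (diagram alpha)).
Local Notation x := (wLT n alpha).
Implicit Types (p q : 'I_n) (b : nat * nat).

Lemma size_diag : size (diagram alpha) = n.
Proof. by have [/andP [_ /eqP <-] _] := alpha_peak; apply: size_diagram. Qed.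

Lemma part_gt0 r : (r < l)%N -> (0 < nth 0%N alpha r)%N.
Proof.
by have [/andP [/allP pos _] _] := alpha_peak; move=> lt_r; apply/pos/mem_nth.
Qed.

Lemma part_gt1 r : (r.+1 < l)%N -> (1 < nth 0%N alpha r)%N.
Proof.
have [_ peak] := alpha_peak; move=> lt_r.
by have := peak r lt_r; have := part_gt0 (ltnW lt_r); lia.
Qed.

Lemma box_bounds p : ((box p).1 < l)%N /\ ((box p).2 < nth 0%N alpha (box p).1)%N.
Proof. by apply/andP; rewrite -mem_diagram mem_nth ?size_diag. Qed.

Lemma box_ltE p q : (p < q)%N = read_before (box p) (box q).
Proof.
have lt_box (a b : 'I_n) : (a < b)%N -> read_before (box a) (box b).
  move=> lt_ab; apply: (sorted_ltn_nth read_before_trans) => //.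
  - exact: diagram_sorted.
  - by rewrite inE size_diag.
  - by rewrite inE size_diag.
apply/idP/idP => [/lt_box //|]; case: ltngtP => // [/lt_box|/val_inj ->].
  by rewrite /read_before; lia.
by rewrite /read_before; lia.
Qed.

Lemma boxP b : (b.1 < l)%N -> (b.2 < nth 0%N alpha b.1)%N -> exists p : 'I_n, box p = b.
Proof.
move=> h1 h2; have bd : b \in diagram alpha by rewrite mem_diagram h1.
have lt_b : (index b (diagram alpha) < n)%N by rewrite -size_diag index_mem.
by exists (Ordinal lt_b); rewrite /= nth_index.
Qed.

(** The boxes read before row [r] are those of the [l.-1 - r] rows above it, whose lengths begin
    [rev alpha]. *)
Lemma box_row_start r : (r < l)%N ->
  exists2 p : 'I_n, p = sumn (take (l.-1 - r) (rev alpha)) :> nat & box p = (r, 0%N).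
Proof.
move=> lt_r; set k := (l.-1 - r)%N; set R := rev (iota 0 l).
have eR : R = take k R ++ r :: drop k.+1 R.
  have sR : (k < size R)%N by rewrite size_rev size_iota /k; lia.
  rewrite -{1}(cat_take_drop k R) (drop_nth 0%N) //; congr (_ ++ _ :: _).
  by rewrite nth_rev ?size_iota ?nth_iota /k; lia.
have [A [B [ed eA]]] : exists A B, diagram alpha = A ++ (r, 0%N) :: B /\
    size A = sumn (take k (rev alpha)).
  rewrite /diagram -/R eR map_cat flatten_cat /=.
  case: (nth 0%N alpha r) (part_gt0 lt_r) => // m _ /=.
  do 2!eexists; split=> //; rewrite size_allpairs_dep map_take.
  congr (sumn (take k _)); rewrite /R map_rev; congr rev.
  by rewrite -[RHS](mkseq_nth 0%N); apply: eq_map => r' /=; apply: size_iota.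
have lt_A : (size A < n)%N.
  by rewrite -size_diag ed size_cat /= addnS ltnS leq_addr.
by exists (Ordinal lt_A) => //=; rewrite ed nth_cat ltnn subnn.
Qed.

(** Positions count from 0, so the partial sum [i.+1] is the position [ord_hi i], and it is a
    partial sum exactly when a new row starts there. *)
Lemma in_comp_set (i : 'I_n.-1) :
  (i \in comp_set n (rev alpha)) = ((box (ord_lo i)).1 != (box (ord_hi i)).1).
Proof.
rewrite inE size_rev; apply/mapP/idP => [[k + ei]|neq].
  rewrite mem_iota => /andP [k_gt0 lt_k].
  have lt_r : (l.-1 - k < l)%N by lia.
  have [p] := box_row_start lt_r; rewrite subKn -?ei; last by lia.
  move=> ep box_p; have {ep} ep : p = ord_hi i by apply: val_inj.
  have := box_ltE (ord_lo i) (ord_hi i); rewrite ltnSn -ep box_p.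
  by rewrite /read_before /=; lia.
have lt_i : (ord_lo i < ord_hi i)%N by [].
have [lt_lo _] := box_bounds (ord_lo i).
have [lt_hi pos_hi] := box_bounds (ord_hi i).
have row_lt : ((box (ord_hi i)).1 < (box (ord_lo i)).1)%N.
  by move: neq lt_i; rewrite box_ltE /read_before; lia.
have [p ep] : exists p : 'I_n, box p = ((box (ord_hi i)).1, 0%N).
  by apply: boxP => //=; apply: leq_ltn_trans pos_hi.
have lt_p : (ord_lo i < p)%N by rewrite box_ltE ep /read_before /= row_lt.
have : ~~ (ord_hi i < p)%N.
  by rewrite box_ltE ep /read_before /= ltnn eqxx.
rewrite -leqNgt => le_p; have ei : p = ord_hi i.
  by apply: val_inj; apply/eqP; rewrite eqn_leq le_p lt_p.
exists (l.-1 - (box p).1)%N; first by rewrite mem_iota ei; lia.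
have [p' + ep'] := box_row_start lt_hi; rewrite ei => <-.
suff -> : p' = p by rewrite ei.
apply: val_inj; case: (ltngtP p' p) => //; rewrite box_ltE ep ep' /read_before /=.
  by rewrite ltnn eqxx.
by rewrite ltnn eqxx.
Qed.


(** * Entries in the first two columns and beyond *)

Lemma filling_wLT p : filling n alpha (box p) = (x p).+1.
Proof. by rewrite wLTE // (nth_map (0%N, 0%N)) ?size_diag. Qed.

Lemma wLT_spine p : ((box p).2 < 2)%N -> (x p).+1 = filling12 (box p).
Proof. by rewrite -filling_wLT /filling => ->. Qed.

Lemma wLT_tail p : (2 <= (box p).2)%N ->
  (x p).+1 = nth 0%N (remaining n alpha) (index (box p) (boxes3 alpha)) /\
  (index (box p) (boxes3 alpha) < size (remaining n alpha))%N.
Proof.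
move=> tp; have fE : filling n alpha (box p) =
    nth 0%N (remaining n alpha) (index (box p) (boxes3 alpha)).
  by rewrite /filling ltnNge tp.
rewrite -filling_wLT fE; split=> //; rewrite ltnNge; apply/negP => le_s.
by have := filling_wLT p; rewrite fE nth_default.
Qed.

(** From the third column on, the increasing list [remaining] is placed in reading order. *)
Lemma tail_before p q : (2 <= (box p).2)%N -> (2 <= (box q).2)%N ->
  (x p < x q)%N -> (p < q)%N.
Proof.
move=> tp tq; have [ep sp] := wLT_tail tp; have [eq sq] := wLT_tail tq.
rewrite -ltnS ep eq => lt_pq.
have in3 (r : 'I_n) : (2 <= (box r).2)%N -> box r \in boxes3 alpha.
  by rewrite mem_filter => -> /=; rewrite mem_nth ?size_diag.
have lt_index : (index (box p) (boxes3 alpha) < index (box q) (boxes3 alpha))%N.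
  rewrite ltnNge leq_eqVlt; apply: contraTN lt_pq.
  move=> /orP [/eqP <-|lt_qp]; first by rewrite ltnn.
  have sorted_r : sorted ltn (remaining n alpha).
    by apply: sorted_filter (iota_ltn_sorted _ _); apply: ltn_trans.
  have /= := sorted_ltn_nth ltn_trans 0%N sorted_r _ _ sq sp lt_qp.
  by case: ltngtP.
have sorted_3 : sorted read_before (boxes3 alpha).
  by apply: sorted_filter (diagram_sorted alpha); apply: read_before_trans.
rewrite box_ltE; apply: (sorted_ltn_index read_before_trans sorted_3) => //; exact: in3.
Qed.

(* The first two columns are filled with an initial segment of the integers.  *)
Lemma spine_lt_tail p q : ((box p).2 < 2)%N -> (2 <= (box q).2)%N -> (x p < x q)%N.
Proof.
move=> sp tq; have [eq sq] := wLT_tail tq.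
have : (x q).+1 \in remaining n alpha by rewrite eq mem_nth.
rewrite mem_filter => /andP [/negP out _]; rewrite ltnNge; apply/negP => le_qp.
apply: out; have := wLT_spine sp; have [lt_p col_p] := box_bounds p.
rewrite /filling12 => exp.
have row_q : (x q)./2 = (box p).1 \/ ((x q)./2 < (box p).1)%N.
  by move: exp le_qp sp; case: eqP; lia.
(* These are the r and c with [x q] = 2r + c. The box exists: it is in the row of [p], no further
   right than [p], or in a lower row, which has two boxes. So [(x q).+1] is already used in the
   first two columns. *)
have bd : ((x q)./2, odd (x q) : nat) \in diagram alpha.
  rewrite mem_diagram /=; case: row_q => [erow|lt_row].
    rewrite erow lt_p /=; apply: leq_ltn_trans col_p.
    by move: exp le_qp sp; case: eqP; lia.
  rewrite (ltn_trans lt_row lt_p) /=.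
  by apply: leq_ltn_trans (part_gt1 (leq_ltn_trans lt_row lt_p)); case: odd.
apply/mapP; exists ((x q)./2, odd (x q) : nat).
  by rewrite mem_filter bd /= andbT; case: odd.
by rewrite /filling12 /=; case: eqP; lia.
Qed.

(** Rows are numbered from the bottom but read from the top; reversing the numbering makes it
    increase with the position. *)
Definition row_rank p : nat := (l - (box p).1)%N.

Lemma row_rank_eq p q : (row_rank p == row_rank q) = ((box p).1 == (box q).1).
Proof.
by rewrite /row_rank; have [? _] := box_bounds p; have [? _] := box_bounds q; lia.
Qed.

Lemma row_rank_mono p q : (p <= q)%N -> (row_rank p <= row_rank q)%N.
Proof.
rewrite leq_eqVlt => /orP [/eqP/val_inj -> //|]; rewrite box_ltE /row_rank.
by move=> /orP [lt_r|/andP [/eqP -> _] //]; apply: leq_sub2l; apply: ltnW.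
Qed.

(** * The canonical filling meets the criterion *)

Lemma wLT_row_increasing p q : (p < q)%N -> row_rank p = row_rank q -> (x p < x q)%N.
Proof.
move=> lt_pq /eqP; rewrite row_rank_eq => /eqP erow.
have lt_col : ((box p).2 < (box q).2)%N.
  by move: lt_pq; rewrite box_ltE /read_before erow ltnn eqxx.
have [sq|tq] := ltnP (box q).2 2.
  have sp := ltn_trans lt_col sq; rewrite -ltnS !wLT_spine // /filling12 erow.
  by do !case: eqP; lia.
have [sp|tp] := ltnP (box p).2 2; first exact: spine_lt_tail.
case: ltngtP => // [/(tail_before tq tp)|/val_inj/perm_inj epq].
  by case: ltngtP lt_pq.
by move: lt_pq; rewrite epq ltnn.
Qed.

Lemma box_succ p q : q = p.+1 :> nat -> (box p).1 = (box q).1 ->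
  (box q).2 = (box p).2.+1.
Proof.
move=> eq erow; have lt_pq : (p < q)%N by rewrite eq.
move: (lt_pq); rewrite box_ltE /read_before erow ltnn eqxx /= leq_eqVlt.
move=> /orP [/eqP //|lt_col]; have [lt_q col_q] := box_bounds q.
have [r er] : exists r : 'I_n, box r = ((box q).1, (box p).2.+1).
  by apply: boxP => //=; apply: ltn_trans col_q.
have : (p < r)%N by rewrite box_ltE er /read_before /= erow ltnn eqxx leqnn.
have : (r < q)%N by rewrite box_ltE er /read_before /= ltnn eqxx.
by rewrite eq; lia.
Qed.

(** Within the first two columns neighbours hold consecutive values. If [q] lies further right, [r]
    is either another box filled in reading order before [q], or a box of the first two columns in a
    higher row than [p]. *)
Lemma wLT_gap p q r : q = p.+1 :> nat -> row_rank p = row_rank q ->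
  (x p < x r)%N -> (x r < x q)%N -> (r < p)%N.
Proof.
move=> eq /eqP; rewrite row_rank_eq => /eqP erow lt_pr lt_rq.
have ecol := box_succ eq erow.
have neq_rp : r != p by apply: contraTneq lt_pr => ->; rewrite ltnn.
have lt_q : (r < q)%N -> (r < p)%N.
  by rewrite eq ltnS leq_eqVlt val_eqE (negPf neq_rp).
have [sq|tq] := ltnP (box q).2 2.
  have sp : ((box p).2 < 2)%N by apply: ltn_trans sq; rewrite ecol.
  move: (wLT_spine sp) (wLT_spine sq); rewrite /filling12 ecol erow.
  by case: eqP => /=; lia.
have [tr|sr] := leqP 2 (box r).2; first by apply/lt_q/tail_before.
have [tp|sp] := leqP 2 (box p).2.
  by have := spine_lt_tail sr tp; case: ltngtP lt_pr.
rewrite box_ltE /read_before erow; apply/orP; left.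
move: (wLT_spine sp) (wLT_spine sr); rewrite /filling12 erow.
by do !case: eqP; lia.
Qed.

(** The first box of row r holds 2r, and the second box of row r - 1 holds 2r - 1; the latter exists
    by the peak condition. Outside row r, only the first box of row r - 1, with 2r - 2, is read
    between them. *)
Lemma wLT_row_start p q : (p < q)%N -> row_rank p != row_rank q ->
    (forall p0, p = p0.+1 :> nat -> row_rank p0 != row_rank p) ->
  exists p' : 'I_n, [/\ (p < p')%N, x p = (x p').+1 :> nat &
    forall q', (p < q')%N -> (q' < p')%N -> row_rank p != row_rank q' ->
      (x q' < x p)%N].
Proof.
move=> lt_pq; rewrite row_rank_eq => nrow start.
have [lt_p col_p] := box_bounds p.
have col0 : (box p).2 = 0%N.
  apply/eqP; rewrite -leqn0 leqNgt; apply/negP => col_gt0.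
  have [r er] : exists r : 'I_n, box r = ((box p).1, (box p).2.-1).
    by apply: boxP => //=; apply: leq_ltn_trans col_p; apply: leq_pred.
  have lt_rp : (r < p)%N by rewrite box_ltE er /read_before /= eqxx; lia.
  have lt_r1 : (r.+1 < n)%N by apply: leq_ltn_trans (ltn_ord p).
  case: (ltngtP r.+1 p) lt_rp => // [lt_r1p _|/esym/start + _]; last first.
    by rewrite row_rank_eq er eqxx.
  have : (r < Ordinal lt_r1)%N by [].
  have : (Ordinal lt_r1 < p)%N by [].
  by rewrite !box_ltE er /read_before /=; lia.
have row_q : ((box q).1 < (box p).1)%N.
  by move: lt_pq nrow; rewrite box_ltE => /orP [//|/andP [/eqP -> _]]; rewrite eqxx.
have eprow : ((box p).1.-1.+1 = (box p).1) by apply: prednK; apply: leq_ltn_trans row_q.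
have [p' ep'] : exists p' : 'I_n, box p' = ((box p).1.-1, 1%N).
  by apply: boxP => /=; [lia | apply: part_gt1; rewrite eprow].
have lt_pp' : (p < p')%N by rewrite box_ltE ep' /read_before /= -{2}eprow leqnn.
have xp : (x p).+1 = (box p).1.*2.+1 by rewrite wLT_spine /filling12 col0.
exists p'; split=> //.
  have : (x p').+1 = (box p).1.*2 by rewrite wLT_spine /filling12 ep' //= eprow.
  by lia.
move=> q'; rewrite (box_ltE p) (box_ltE q') row_rank_eq ep' /read_before /= col0 => lt1 lt2 nrow'.
have eq' : (box q').1 = (box p).1.-1 /\ (box q').2 = 0%N.
  move: lt1 lt2; rewrite (negPf nrow') orbF => lt1 /orP [|/andP [/eqP]]; lia.
have := @wLT_spine q'; rewrite /filling12 eq'.1 eq'.2 => /(_ isT) /=; lia.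
Qed.

End Diagram.

Theorem corollary5p25 (R : realType) (n : nat) (n_gt0 : (0 < n)%N)
    (alpha : seq nat) (alpha_peak : is_peak_composition n alpha) :
  indecomposable (Qr R[i] n alpha).
Proof.
have rho_S (i : 'I_n.-1) : (i \in comp_set n (rev alpha)) =
    (row_rank alpha (ord_lo i) != row_rank alpha (ord_hi i)).
  by rewrite in_comp_set // row_rank_eq.
apply: (@interval_indecomposable _ _ _ _ (@row_rank n alpha)).
- exact: row_rank_mono.
- exact: invset_w1 (row_rank_mono alpha_peak) rho_S.
- exact: wLT_row_increasing.
- exact: wLT_gap.
- exact: wLT_row_start.
Qed.
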